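(* Every 3-connected cubic graph of tree-width 3 has a 3-decomposition.
   Context: All graphs are finite and simple; cubic means 3-regular. A 3-decomposition of a graph $G$ is a partition of $E(G)$ into the edge sets of a spanning tree, a (possibly empty) 2-regular subgraph, and a (possibly empty) matching. *)

(* Defs.v *)
(* A finite simple graph is a symmetric irreflexive relation
   e : rel T on a finType T; edges are 2-element vertex sets {x, y}. *)
From mathcomp Require Import all_boot.
Set Implicit Arguments. Unset Strict Implicit. Unset Printing Implicit Defensive.

Section Graphs.
Variable T : finType.

Definition rel_connected (r : rel T) : Prop := forall x y : T, connect r x y.

Definition rel_acyclic (r : rel T) : Prop :=
  forall s : seq T, 2 < size s -> uniq s -> ~~ cycle r s.

Definition is_tree (r : rel T) : Prop :=
  0 < #|T| /\ rel_connected r /\ rel_acyclic r.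

Variable e : rel T.

Definition edges : {set {set T}} := [set [set x; y] | x in T, y in T & e x y].

Definition erel (F : {set {set T}}) : rel T := fun x y => [set x; y] \in F.

Definition deg (F : {set {set T}}) (v : T) : nat :=
  #|[set f in F | v \in f]|.

Definition cubic : Prop := forall x : T, #|[set y | e x y]| = 3.

Definition connected_on (A : {set T}) : Prop :=
  forall x y, x \in A -> y \in A ->
    connect [rel u v | [&& e u v, u \in A & v \in A]] x y.

Definition k_connected (k : nat) : Prop :=
  k < #|T| /\ forall S : {set T}, #|S| < k -> connected_on (~: S).

Definition spanning_tree (F : {set {set T}}) : Prop :=
  F \subset edges /\ is_tree (erel F).

Definition two_regular (F : {set {set T}}) : Prop :=
  F \subset edges /\ forall v, deg F v = 0 \/ deg F v = 2.

Definition matching (F : {set {set T}}) : Prop :=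
  F \subset edges /\ forall v, deg F v <= 1.

Definition three_decomposition : Prop :=
  exists F1 F2 F3 : {set {set T}},
    [/\ F1 :|: F2 :|: F3 = edges,
        [&& [disjoint F1 & F2], [disjoint F1 & F3] & [disjoint F2 & F3]],
        spanning_tree F1, two_regular F2 & matching F3].

End Graphs.

Definition tree_decomposition (T : finType) (e : rel T)
    (I : finType) (t : rel I) (B : I -> {set T}) : Prop :=
  [/\ [/\ symmetric t, irreflexive t & is_tree t],
      (forall v : T, exists i, v \in B i),
      (forall x y : T, e x y -> exists i, (x \in B i) && (y \in B i))
    & (forall (v : T) (i j : I), v \in B i -> v \in B j ->
         connect [rel a b | [&& t a b, v \in B a & v \in B b]] i j)].

Definition has_td_of_width_le (T : finType) (e : rel T) (w : nat) : Prop :=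
  exists (I : finType) (t : rel I) (B : I -> {set T}),
    tree_decomposition e t B /\ forall i, #|B i| <= w.+1.

Definition treewidth_eq (T : finType) (e : rel T) (w : nat) : Prop :=
  has_td_of_width_le e w /\
  forall w', w' < w -> ~ has_td_of_width_le e w'.

(* Main.v *)
Require Import Defs.
From mathcomp Require Import all_boot.
From mathcomp Require Import zify.

(** Colour the edges with 0 (tree), 1 (cycle) and 2 (matching). Call a vertex set
    X with three boundary edges good if every colouring of its boundary that could
    occur at a vertex extends to X so that each vertex of X sees tree-tree-tree,
    tree-tree-matching or tree-cycle-cycle and the tree edges span X as a tree.
    If X is partitioned into good sets such that collapsing these, and the outside
    of X, to points yields K4, K33 or the cube, then X is good.

    In a tree decomposition of width 3, let C be a connected set with N(C) inside a
    bag that C avoids. Some bag is N(C) + x with x in C, and every component D of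
    C - x is again such a set with N(D) = x + two vertices of N(C). Counting the
    edges at x and at N(C) leaves few configurations, and each shows by induction
    that C, together with the vertices having at least two neighbours in C, is good.
    A minimal such C is a single vertex v whose closed neighbourhood is a bag; the
    same analysis makes V - v good, and colouring the edges at v
    tree-cycle-cycle gives the decomposition. *)

Set Implicit Arguments. Unset Strict Implicit. Unset Printing Implicit Defensive.

(** * Trees on a vertex set *)

Section Trees.
Variable T : finType.
Implicit Types (r : rel T) (A B X Z : {set T}).

(** A good set can stand in for a single vertex: it has three boundary edges, admits every boundary
    colouring that a vertex admits, and its tree edges span it, so expanding a vertex of a quotient
    into it keeps spanning trees spanning trees. A large set is thus filled by colouring a small
    cubic quotient and then filling each part on its own. A set C behind a bag may have up to six
    boundary edges, two at each vertex of N(C); absorbing the vertices with two neighbours in C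
    brings this down to three. 3-connectivity gives N(C) at least three vertices and each of them an
    edge leading away from C; a bag with four places leaves room for no more than three. Each
    component of C - x uses an edge at x, so there are at most three. Three of them give the cube;
    two that avoid the same vertex of N(C) give K33; the other cases reduce to K4, once or twice, to
    a smaller good set, or to a single vertex. The outside is shrunk to one vertex v because the
    colours at v can then be chosen freely. *)

Definition linked r X := forall Z, Z \subset X -> Z != set0 -> Z != X ->
  exists x y, [/\ x \in Z, y \in X, y \notin Z & r x y].

Definition leaf r Z u := forall a b, a \in Z -> b \in Z -> r u a -> r u b -> a = b.

(** Two leaves are demanded, not one, because an edge that joins two trees may spoil one of them.
    Quantifying over subsets, here and in [linked], avoids paths: a subset of a union splits into
    its traces on the two parts. *)
Definition forest_on r X := forall Z, Z \subset X -> 1 < #|Z| ->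
  exists u v, [/\ u \in Z, v \in Z, u != v, leaf r Z u & leaf r Z v].

Definition tree_on r X := [/\ X != set0, linked r X & forest_on r X].

Lemma tree_on_ext r r' X :
  {in X &, r =2 r'} -> tree_on r X -> tree_on r' X.
Proof.
move=> E [X0 L F]; split=> // Z ZX.
  move=> Z0 ZnX; have [x [y [xZ yX yZ rxy]]] := L Z ZX Z0 ZnX.
  by exists x, y; split=> //; rewrite -E // (subsetP ZX).
have leafE u : u \in Z -> leaf r Z u -> leaf r' Z u.
  by move=> uZ lu a b aZ bZ; rewrite -!E ?(subsetP ZX) //; apply: lu.
by move=> /(F Z ZX) [u [v [uZ vZ uv lu lv]]]; exists u, v; split=> //; apply: leafE.
Qed.

Lemma tree_on1 r x : tree_on r [set x].
Proof.
split; first by apply/set0Pn; exists x; rewrite inE.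
  move=> Z; rewrite subset1 => /orP[/eqP-> _|/eqP->]; by rewrite eqxx.
by move=> Z /subset_leq_card; rewrite cards1 => h1 h2; move: (leq_trans h2 h1).
Qed.

(** Only [a] has neighbours in [B], and of two leaves of the trace on [A] one differs from [a]. If
    the trace is a single vertex, its only possible neighbour in [Z] is [b]. *)
Lemma join_leaf r A B Z a b :
  irreflexive r -> forest_on r A -> [disjoint A & B] -> Z \subset A :|: B ->
  Z :&: A != set0 ->
  (forall x y, x \in A -> y \in B -> r x y -> x = a /\ y = b) ->
  exists2 u, u \in Z :&: A & leaf r Z u.
Proof.
move=> rI F dAB ZAB Z0 ab.
have ZP z : z \in Z -> z \notin A -> z \in B.
  by move/(subsetP ZAB); rewrite inE => /orP[->|].
case: (ltnP 1 #|Z :&: A|) => [c2|c1].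
  have [|u [v [uZ vZ uv lu lv]]] := F (Z :&: A) _ c2; first exact: subsetIr.
  have noa w : w \in Z :&: A -> w != a -> leaf r (Z :&: A) w -> leaf r Z w.
    move=> /setIP[wZ wA] wa lw.
    have inA x : x \in Z -> r w x -> x \in A.
      by move=> xZ rwx; apply: contraNT wa => /(ZP _ xZ) xB; have [-> _] := ab _ _ wA xB rwx.
    by move=> x y xZ yZ rx ry; apply: lw; rewrite // inE ?xZ ?yZ inA.
  case: (eqVneq u a) => ua; last by exists u => //; apply: noa.
  by exists v => //; apply: noa => //; rewrite -ua eq_sym.
have [u uZA] := set0Pn _ Z0; exists u => //.
have /cards1P [u' E] : #|Z :&: A| == 1 by rewrite eqn_leq c1 card_gt0.
have eu : u = u' by apply/set1P; rewrite -E.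
case/setIP: uZA => uZ uA.
have inB x : x \in Z -> r u x -> x \in B.
  move=> xZ rux; apply: ZP => //; apply/negP => xA.
  have : x \in Z :&: A by rewrite inE xZ.
  by rewrite E -eu => /set1P xu; rewrite xu rI in rux.
move=> x y xZ yZ rx ry.
by have [_ ->] := ab _ _ uA (inB _ xZ rx) rx; have [_ ->] := ab _ _ uA (inB _ yZ ry) ry.
Qed.

Lemma tree_join r A B a b :
  symmetric r -> irreflexive r -> tree_on r A -> tree_on r B -> [disjoint A & B] ->
  a \in A -> b \in B -> r a b ->
  (forall x y, x \in A -> y \in B -> r x y -> x = a /\ y = b) ->
  tree_on r (A :|: B).
Proof.
move=> rS rI [A0 LA FA] [B0 LB FB] dAB aA bB rab ab; split.
- by apply/set0Pn; exists a; rewrite inE aA.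
- move=> Z ZAB Z0 ZnAB.
  case: (boolP ((Z :&: A != set0) && (Z :&: A != A))) => [/andP[h1 h2]|hA].
    have [x [y [/setIP[xZ _] yA]]] := LA _ (subsetIr Z A) h1 h2.
    by rewrite inE yA andbT => yZ rxy; exists x, y; split; rewrite // inE yA.
  case: (boolP ((Z :&: B != set0) && (Z :&: B != B))) => [/andP[h1 h2]|hB].
    have [x [y [/setIP[xZ _] yB]]] := LB _ (subsetIr Z B) h1 h2.
    by rewrite inE yB andbT => yZ rxy; exists x, y; split; rewrite // inE yB orbT.
  have ZE : Z = (Z :&: A) :|: (Z :&: B) by rewrite -setIUr; apply/esym/setIidPl.
  (* [Z] now contains all or nothing of each of [A] and [B]; in the two mixed cases the edge from
     [a] to [b] leaves it. *)
  move: hA hB; rewrite !negb_and !negbK => /orP[/eqP hA|/eqP hA] /orP[/eqP hB|/eqP hB].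
  + by rewrite ZE hA hB setU0 eqxx in Z0.
  + exists b, a; split; rewrite ?inE ?aA //.
    * by move: bB; rewrite -{1}hB => /setIP[].
    * by apply/negP => aZ; have : a \in Z :&: A by [rewrite inE aZ]; rewrite hA inE.
    * by rewrite rS.
  + exists a, b; split; rewrite ?inE ?bB ?orbT //.
    * by move: aA; rewrite -{1}hA => /setIP[].
    * by apply/negP => bZ; have : b \in Z :&: B by [rewrite inE bZ]; rewrite hB inE.
  + by rewrite ZE hA hB eqxx in ZnAB.
- move=> Z ZAB Z1.
  case: (boolP (Z :&: A == set0)) => [/eqP ZA|ZA].
    apply: FB => //; apply/subsetP => z zZ; move: (subsetP ZAB _ zZ).
    rewrite inE => /orP[zA|//]; have : z \in Z :&: A by rewrite inE zZ.
    by rewrite ZA inE.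
  case: (boolP (Z :&: B == set0)) => [/eqP ZB|ZB].
    apply: FA => //; apply/subsetP => z zZ; move: (subsetP ZAB _ zZ).
    rewrite inE => /orP[//|zB]; have : z \in Z :&: B by rewrite inE zZ.
    by rewrite ZB inE.
  have [u uA lu] := join_leaf rI FA dAB ZAB ZA ab.
  have [v vB lv] : exists2 v, v \in Z :&: B & leaf r Z v.
    apply: (@join_leaf r B A Z b a) => //; first by rewrite disjoint_sym.
      by rewrite setUC.
    by move=> x y xB yA; rewrite rS => /(ab _ _ yA xB) [].
  exists u, v; case/setIP: uA => uZ uA; case/setIP: vB => vZ vB; split=> //.
  by apply: contraTneq vB => <-; rewrite (disjointFr dAB).
Qed.

Lemma tree_on_is_tree r : symmetric r -> tree_on r setT -> is_tree r.
Proof.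
move=> rS [T0 L F]; split; [|split].
- by rewrite -cardsT card_gt0.
- move=> x y; pose Z := [set z | connect r x z].
  case: (boolP (Z == setT)) => [/eqP ZT|ZT].
    by have : y \in Z by [rewrite ZT inE]; rewrite inE.
  have Z0 : Z != set0 by apply/set0Pn; exists x; rewrite inE connect0.
  have [a [b []]] := L Z (subsetT _) Z0 ZT.
  rewrite !inE => xa _ /negP nxb rab; case: nxb.
  exact: connect_trans xa (connect1 rab).
- move=> s s2 us; apply/negP => cs.
  have [||u [_ [us' _ _ lu _]]] := F [set x in s]; rewrite ?subsetT //.
    by rewrite cardsE (card_uniqP us) ltnW.
  move: us'; rewrite inE => us'; case: (rot_to us') => i s' E.
  have ms z : (z \in s) = (z \in u :: s') by rewrite -E mem_rot.
  move: cs us s2; rewrite -(rot_cycle i) -(rot_uniq i) -(size_rot i) E.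
  case: s' ms {E} => [|y s'] // ms; case/lastP: s' ms => // s' z ms.
  rewrite /= rcons_path last_rcons rcons_path => /and3P[ruy _ rzu] un _.
  (* [y] and [z] are the successor and the predecessor of the leaf [u] on the cycle. *)
  have yz : y = z.
    apply: (lu y z); rewrite ?inE ?ms ?inE ?mem_rcons ?inE ?eqxx ?orbT //.
    by rewrite rS.
  by move: un; rewrite yz mem_rcons inE eqxx !andbF.
Qed.

End Trees.

(** * Colourings and quotient patterns *)

Definition symm (T : Type) (c : T -> T -> nat) := forall x y, c x y = c y x.

(* The three colours at a vertex sum to 0 or 2 exactly for 0+0+0, 0+0+2 and 0+1+1. *)
Definition valid n := (n == 0) || (n == 2).

Definition grel (E : seq (nat * nat)) i j := ((i, j) \in E) || ((j, i) \in E).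

(* Reading s from the right, each vertex is joined to the earlier ones by one tree edge. *)
Fixpoint tree_order (H : nat -> nat -> bool) (h : nat -> nat -> nat) s :=
  if s is x :: s' then tree_order H h s' &&
    ((s' == [::]) || (count (fun j => H x j && (h x j == 0)) s' == 1))
  else true.

(* In a quotient graph H the parts are 0, ..., n-1 and the outside is n; b i is the
   colour of the boundary edge at part i, or 0 if there is none. *)
Definition fillable n (H : nat -> nat -> bool) := forall b : nat -> nat,
  (forall i, i < n -> ~~ H i n -> b i = 0) -> valid (\sum_(0 <= i < n) b i) ->
  exists h s, [/\ symm h,
    forall i, i < n -> valid (\sum_(0 <= j < n) H i j * h i j + b i),
    perm_eq s (iota 0 n) & tree_order H h s].

Section Fillings.
Variables (T : finType) (e : rel T).
Hypotheses (e_sym : symmetric e) (e_irr : irreflexive e).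
Implicit Types (A B X Z : {set T}) (c w : T -> T -> nat).

(** For [[set v]] and its complement this is the sum of the colours at [v]; for [X] and its
    complement, the sum over the boundary of [X]. *)
Definition cross w A B :=
  \sum_(p : T * T | [&& p.1 \in A, p.2 \in B & e p.1 p.2]) w p.1 p.2.

Definition cut := cross (fun _ _ => 1).

Definition trel c : rel T := fun x y => e x y && (c x y == 0).

(** Since [c'] may differ from [c] only on pairs inside [X], boundary edges keep their colours and
    disjoint good sets can be filled independently. *)
Definition good X := cut X (~: X) = 3 /\
  forall c, symm c -> valid (cross c X (~: X)) ->
  exists c', [/\ symm c',
    forall x y, ~~ ((x \in X) && (y \in X)) -> c' x y = c x y,
    forall v, v \in X -> valid (cross c' [set v] (~: [set v])) &
    tree_on (trel c') X].

Definition adj A B := [exists x in A, exists y in B, e x y].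

Lemma adjP A B : reflect (exists x y, [/\ x \in A, y \in B & e x y]) (adj A B).
Proof.
apply: (iffP exists_inP) => [[x xA /exists_inP[y yB exy]]|[x [y [xA yB exy]]]].
  by exists x, y.
by exists x => //; apply/exists_inP; exists y.
Qed.

Lemma adjC A B : adj A B = adj B A.
Proof.
by apply/adjP/adjP => -[x [y [xA yB exy]]]; exists y, x; split; rewrite // e_sym.
Qed.

Lemma eq_cross w w' A B : (forall x y, x \in A -> y \in B -> e x y -> w x y = w' x y) ->
  cross w A B = cross w' A B.
Proof. by move=> E; apply: eq_bigr => p /and3P[]; apply: E. Qed.

Lemma cross_const w A B k : (forall x y, x \in A -> y \in B -> w x y = k) ->
  cross w A B = cut A B * k.
Proof.
move=> E; rewrite /cut /cross big_distrl /=.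
by apply: eq_bigr => p /and3P[h1 h2 _]; rewrite mul1n E.
Qed.

Lemma cutE A B : cut A B = #|[set p : T * T | [&& p.1 \in A, p.2 \in B & e p.1 p.2]]|.
Proof. by rewrite /cut /cross sum1dep_card. Qed.

Lemma cut_gt0 A B : (0 < cut A B) = adj A B.
Proof.
rewrite cutE card_gt0; apply/set0Pn/adjP => [[[x y]]|[x [y [xA yB exy]]]].
  by rewrite inE => /and3P[]; exists x, y.
by exists (x, y); rewrite inE /= xA yB.
Qed.

Lemma cut_eq0 w A B : cut A B = 0 -> cross w A B = 0.
Proof.
move=> E; apply: big1 => p h; suff : 0 < cut A B by rewrite E.
by rewrite cut_gt0; apply/adjP; exists p.1, p.2; apply/and3P.
Qed.

Lemma cut_eq1 A B : cut A B = 1 -> exists a b, [/\ a \in A, b \in B, e a b &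
  forall x y, x \in A -> y \in B -> e x y -> x = a /\ y = b].
Proof.
rewrite cutE => /eqP /cards1P[[a b] E].
have /and3P[aA bB eab] : [&& a \in A, b \in B & e a b].
  by have := set11 (a, b); rewrite -E inE.
exists a, b; split=> // x y xA yB exy.
have : (x, y) \in [set (a, b)] by rewrite -E inE /= xA yB.
by move/set1P => [-> ->].
Qed.

Section Labels.
Variables (n : nat) (lab : T -> nat).
Hypothesis lab_le : forall x, lab x <= n.
Let P i := [set x | lab x == i].

Lemma cross_labr w A B :
  cross w A B = \sum_(0 <= j < n.+1) cross w A [set y in B | lab y == j].
Proof.
rewrite /cross big_mkord (partition_big (fun p => inord (lab p.2) : 'I_n.+1) xpredT) //=.
apply: eq_bigr => j _; apply: eq_bigl => p.
rewrite inE -val_eqE /= inordK ?ltnS //.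
by case: (_ \in A); case: (_ \in B); case: (e _ _); case: (_ == _).
Qed.

Lemma cross_labl w A B :
  cross w A B = \sum_(0 <= j < n.+1) cross w [set y in A | lab y == j] B.
Proof.
rewrite /cross big_mkord (partition_big (fun p => inord (lab p.1) : 'I_n.+1) xpredT) //=.
apply: eq_bigr => j _; apply: eq_bigl => p.
rewrite inE -val_eqE /= inordK ?ltnS //.
by case: (_ \in A); case: (_ \in B); case: (e _ _); case: (_ == _).
Qed.

Lemma cross_lab_compl w i :
  cross w (P i) (~: P i) = \sum_(0 <= j < n.+1) (j != i) * cross w (P i) (P j).
Proof.
rewrite cross_labr; apply: eq_bigr => j _; case: eqVneq => [->|ji].
  rewrite mul0n; apply: big1 => p /and3P[_]; rewrite !inE.
  by case: (_ == i).
rewrite mul1n; congr (cross _ _ _); apply/setP => y; rewrite !inE.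
by case: (eqVneq (lab y) j) => [->|]; rewrite ?ji ?andbF.
Qed.

Lemma cross_lab_inner w :
  cross w [set x | lab x < n] (~: [set x | lab x < n]) = \sum_(0 <= i < n) cross w (P i) (P n).
Proof.
rewrite cross_labl big_nat_recr //= [X in _ + X]big1 ?addn0.
  apply: eq_big_nat => i /andP[_ i_n]; congr (cross _ _ _); apply/setP => x; rewrite !inE.
    by case: eqP => [->|]; rewrite ?i_n ?andbF.
  by rewrite -leqNgt eqn_leq lab_le.
by move=> p /and3P[]; rewrite !inE => /andP[h /eqP E]; rewrite E ltnn in h.
Qed.

Variable H : nat -> nat -> bool.
Hypothesis H_irr : forall i, H i i = false.
Hypothesis H_cubic : forall i, i < n -> \sum_(0 <= j < n.+1) H i j = 3.
Hypothesis H_out : \sum_(0 <= i < n) H i n = 3.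
Hypothesis H_adj : forall i j, i < n -> j <= n -> H i j -> adj (P i) (P j).
Hypothesis P_good : forall i, i < n -> good (P i).

(** Every edge of [H] at [i] costs part [i] at least one boundary edge, and both totals are 3.
    Equality therefore holds term by term, so adjacency is all that has to be checked for a
    pattern. *)
Lemma cut_lab i j : i < n -> j <= n -> i != j -> cut (P i) (P j) = H i j.
Proof.
move=> i_n j_n ij.
have le k : k <= n -> H i k <= (k != i) * cut (P i) (P k).
  move=> kn; case Hik: (H i k) => //.
  have ki : k != i by apply: contraTneq Hik => ->; rewrite H_irr.
  by rewrite ki mul1n cut_gt0 H_adj.
have E : \sum_(0 <= k < n.+1) ((k != i) * cut (P i) (P k) - H i k) = 0.
  rewrite !big_mkord sumnB => [|k _]; last by apply: le; rewrite -ltnS.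
  have := H_cubic i_n; have := (P_good i_n).1.
  by rewrite /cut cross_lab_compl !big_mkord => -> ->.
have := leqnn 0; rewrite -{1}E leqn0 sum_nat_seq_eq0 => /allP /(_ j).
rewrite mem_index_iota ltnS j_n => /(_ isT) /=; rewrite subn_eq0.
have := le j j_n; rewrite eq_sym ij mul1n => h1 h2.
by apply/eqP; rewrite eqn_leq h1 h2.
Qed.

(** Filling one part changes no edge that leaves it, so the boundary sums of later parts and the
    sums and trees of earlier ones survive. *)
Lemma fill_parts m c : m <= n -> symm c ->
  (forall i, i < m -> valid (cross c (P i) (~: P i))) ->
  exists c', [/\ symm c',
    forall x y, ~~ ((lab x == lab y) && (lab x < m)) -> c' x y = c x y &
    forall i, i < m -> (forall v, v \in P i -> valid (cross c' [set v] (~: [set v]))) /\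
      tree_on (trel c') (P i)].
Proof.
elim: m => [|m IH] mn cS cV; first by exists c.
have [|c1 [c1S c1E c1F]] := IH (ltnW mn) cS; first by move=> i im; apply: cV; apply: ltnW.
have [|c2 [c2S c2E c2V c2T]] := (P_good mn).2 c1 c1S.
  rewrite (@eq_cross _ c) ?cV // => x y; rewrite !inE => /eqP xm ym _.
  by apply: c1E; rewrite xm eq_sym (negbTE ym).
exists c2; split=> // [x y|i].
  rewrite ltnS => h; rewrite c2E ?c1E //.
    by apply: contra h => /andP[-> /ltnW].
  by apply: contra h; rewrite !inE => /andP[/eqP -> /eqP ->]; rewrite eqxx leqnn.
rewrite ltnS leq_eqVlt => /orP[/eqP->|im]; first by split.
have E x y : x \in P i -> c2 x y = c1 x y.
  rewrite inE => /eqP xi; apply: c2E; rewrite !inE xi.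
  by rewrite (ltn_eqF im).
have [V Tr] := c1F i im; split=> [v vi|].
  rewrite (@eq_cross _ c1) ?V // => x y /set1P-> _ _; exact: E.
by apply: tree_on_ext Tr => x y xi yi; rewrite /trel E.
Qed.

(** Induction along [s]: the new part has colour 0 towards exactly one earlier part, and a single
    edge runs between the two, so [tree_join] applies. *)
Lemma tree_of_order h c s : symm c ->
  (forall x y, lab x < n -> lab y < n -> lab x != lab y -> c x y = h (lab x) (lab y)) ->
  (forall i, i < n -> tree_on (trel c) (P i)) ->
  uniq s -> all (fun i => i < n) s -> s != [::] -> tree_order H h s ->
  tree_on (trel c) [set x | lab x \in s].
Proof.
move=> cS cE cT; elim: s => [//|i s IH] /andP[i_s us] /andP[i_n sn] _ /andP[os].
have E : [set x | lab x \in i :: s] = P i :|: [set x | lab x \in s].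
  by apply/setP => x; rewrite !inE.
case: (eqVneq s [::]) => [-> _|s0 /=].
  have -> : [set x | lab x \in [:: i]] = P i by apply/setP => x; rewrite !inE.
  exact: cT.
move=> /eqP cnt; have Ts := IH us sn s0 os; rewrite {}E.
have sP j : j \in s -> j < n /\ i != j.
  move=> js; split; first exact: (allP sn).
  by apply: contraNneq i_s => ->.
have cntE : count (fun j => H i j && (h i j == 0)) s =
  count (mem [seq j <- s | H i j && (h i j == 0)]) s.
  by apply: eq_in_count => j js; rewrite /= mem_filter js andbT.
have /has_nthP : has (fun j => H i j && (h i j == 0)) s by rewrite has_count cnt.
move=> /(_ 0) [k ks /andP[Hk hk]]; set j := nth 0 s k in Hk hk.
have js : j \in s by apply: mem_nth.
have uj j' : j' \in s -> H i j' -> h i j' == 0 -> j' = j.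
  move=> j's Hj' hj'; pose F := [seq j <- s | H i j && (h i j == 0)].
  have : size F = 1 by rewrite size_filter.
  have jF : j \in F by rewrite mem_filter Hk hk js.
  have : j' \in F by rewrite mem_filter Hj' hj' j's.
  by case: (F) jF => [|z [|//]] //; rewrite !inE => /eqP -> /eqP ->.
have [jn ij] := sP j js.
have [a [b [aP bP eab ab]]] : exists a b, [/\ a \in P i, b \in P j, e a b &
  forall x y, x \in P i -> y \in P j -> e x y -> x = a /\ y = b].
  by apply: cut_eq1; rewrite cut_lab ?Hk ?(ltnW jn).
have cEi x y : x \in P i -> lab y \in s -> c x y = h i (lab y).
  by rewrite inE => /eqP xi /sP[yn iy]; rewrite -xi; apply: cE; rewrite ?xi.
apply: (tree_join (a := a) (b := b)) => //.
- by move=> x y; rewrite /trel e_sym cS.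
- by move=> x; rewrite /trel e_irr.
- exact: cT.
- rewrite disjoint_subset; apply/subsetP => x; rewrite !inE => /eqP ->; exact: i_s.
- by move: bP; rewrite !inE => /eqP ->.
- rewrite /trel eab cEi //; move: bP; rewrite inE => /eqP -> //.
- move=> x y xP; rewrite inE => ys /andP[exy]; rewrite cEi // => hy.
  apply: ab => //; rewrite inE; apply/eqP/uj => //.
  have [yn iy] := sP _ ys; case Hy: (H i _) => //.
  have : 0 < cut (P i) (P (lab y)).
    by rewrite cut_gt0; apply/adjP; exists x, y; split; rewrite // inE.
  by rewrite cut_lab ?Hy // ltnW.
Qed.

Lemma good_labels : 0 < n -> fillable n H -> good [set x | lab x < n].
Proof.
move=> n0 F; split.
  rewrite /cut cross_lab_inner -[RHS]H_out; apply: eq_big_nat => i /andP[_ i_n].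
  by rewrite -/cut cut_lab // ltn_eqF.
move=> c cS; rewrite cross_lab_inner => cV.
have [|h [s [hS hV hs hT]]] := F (fun i => cross c (P i) (P n)) _ cV.
  move=> i i_n Hi; apply: cut_eq0; rewrite cut_lab ?(negbTE Hi) //.
  by rewrite ltn_eqF.
(* Edges between parts take the colours of the quotient, boundary edges keep those of [c], and edges
   inside a part are left to [fill_parts]. *)
pose c1 x y := if [&& lab x < n, lab y < n & lab x != lab y] then h (lab x) (lab y) else c x y.
have c1S : symm c1.
  by move=> x y; rewrite /c1 hS cS eq_sym andbCA.
have [|c2 [c2S c2E c2F]] := fill_parts (leqnn n) c1S.
  move=> i i_n; rewrite cross_lab_compl big_nat_recr //= gtn_eqF // mul1n.
  rewrite (_ : cross c1 _ (P n) = cross c (P i) (P n)); last first.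
    by apply: eq_cross => x y _; rewrite /c1 !inE => /eqP -> _; rewrite ltnn andbF.
  rewrite (_ : \sum_(_ <= _ < _) _ = \sum_(0 <= j < n) H i j * h i j) ?hV //.
  apply: eq_big_nat => j /andP[_ jn].
  case: (eqVneq j i) => [->|ji]; first by rewrite H_irr.
  rewrite mul1n -(cut_lab _ (ltnW jn)) ?[i == j]eq_sym //; apply: cross_const => x y.
  by rewrite !inE /c1 => /eqP -> /eqP ->; rewrite i_n jn eq_sym ji.
exists c2; split=> // [x y|v|].
- rewrite !inE => nxy; rewrite c2E ?/c1; last first.
    by apply: contra nxy => /andP[/eqP <- ->].
  by case: ifP => // /and3P[h1 h2]; rewrite h1 h2 in nxy.
- rewrite inE => vn; apply: (c2F _ vn).1; by rewrite inE.
- have sE : s =i iota 0 n by apply: perm_mem.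
  have -> : [set x | lab x < n] = [set x | lab x \in s].
    by apply/setP => x; rewrite !inE sE mem_iota.
  apply: (tree_of_order (h := h)) => //.
  + move=> x y xn yn xy; rewrite c2E ?(negbTE xy) // /c1 xn yn xy //.
  + by move=> i /c2F[].
  + by rewrite (perm_uniq hs) iota_uniq.
  + by apply/allP => i; rewrite sE mem_iota.
  + by apply/eqP => s0; move: (perm_size hs) n0; rewrite s0 size_iota => <-.
Qed.

End Labels.

(** Serves as the default of [nth], so that the index [size Ps] denotes the outside. *)
Definition out Ps := ~: \bigcup_(A <- Ps) A : {set T}.

Lemma good_quotient H (Ps : seq {set T}) :
  let n := size Ps in
  (forall i, H i i = false) ->
  (forall i, i < n -> \sum_(0 <= j < n.+1) H i j = 3) ->
  \sum_(0 <= i < n) H i n = 3 ->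
  fillable n H -> 0 < n ->
  pairwise (fun A B => [disjoint A & B]) Ps ->
  (forall A, A \in Ps -> good A) ->
  (forall i j, i < n -> j <= n -> H i j -> adj (nth set0 Ps i) (nth (out Ps) Ps j)) ->
  good (\bigcup_(A <- Ps) A).
Proof.
move=> n Hi Hc Ho Hf n0 dis gd ad.
(* Off the union [find] returns [size Ps], which is the label of the outside. *)
pose lab x := find (fun A : {set T} => x \in A) Ps.
have labP x i : i < n -> (lab x == i) = (x \in nth set0 Ps i).
  move=> i_n; apply/eqP/idP => [E|xi].
    by rewrite -E /lab (@nth_find _ set0 (fun A : {set T} => x \in A)) // has_find -/(lab x) E.
  have li : lab x <= i.
    by rewrite leqNgt; apply/negP => /(before_find set0); rewrite xi.
  apply/eqP; move: li; rewrite leq_eqVlt => /orP[//|li].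
  have /(pairwiseP set0) dP := dis.
  have dd := dP (lab x) i (ltn_trans li i_n) i_n li.
  have xl : x \in nth set0 Ps (lab x).
    apply: (@nth_find _ set0 (fun A : {set T} => x \in A)).
    by rewrite has_find (ltn_trans li).
  by rewrite (disjointFr dd xl) in xi.
have bigE : \bigcup_(A <- Ps) A = [set x | lab x < n].
  apply/setP => x; rewrite inE /lab -has_find; apply/idP/hasP.
    by rewrite big_tnth => /bigcupP[i _ xi]; exists (tnth (in_tuple Ps) i) => //; apply: mem_tnth.
  move=> [A AP xA]; rewrite (big_rem A AP) /= inE xA //.
rewrite bigE.
have PE i : i < n -> [set x | lab x == i] = nth set0 Ps i.
  by move=> i_n; apply/setP => x; rewrite inE labP.
apply: (@good_labels n lab _ H) => //.
- by move=> x; apply: find_size.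
- move=> i j i_n jn Hij; rewrite PE //; move: (ad i j i_n jn Hij).
  move: jn; rewrite leq_eqVlt => /orP[/eqP->|jn].
    rewrite [nth (out _) _ _]nth_default // (_ : out Ps = [set x | lab x == n]) //.
    rewrite /out bigE; apply/setP => x; rewrite !inE.
    by rewrite -leqNgt eqn_leq find_size.
  by rewrite PE // (set_nth_default set0).
- by move=> i i_n; rewrite PE //; apply: gd; apply: mem_nth.
Qed.

Lemma good_pattern E (Ps : seq {set T}) :
  let n := size Ps in
  all (fun p => p.1 < p.2 <= n) E && (0 < n) ->
  (forall i, i < n -> \sum_(0 <= j < n.+1) grel E i j = 3) ->
  \sum_(0 <= i < n) grel E i n = 3 ->
  fillable n (grel E) ->
  pairwise (fun A B => [disjoint A & B]) Ps ->
  (forall A, A \in Ps -> good A) ->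
  all (fun p => adj (nth set0 Ps p.1) (nth (out Ps) Ps p.2)) E ->
  good (\bigcup_(A <- Ps) A).
Proof.
move=> n /andP[/allP En n0] Hc Ho Hf dis gd /allP ad.
apply: (good_quotient (H := grel E)) => //.
  by move=> i; rewrite /grel orbb; apply/negP => /En; rewrite ltnn.
move=> i j i_n jn /orP[/ad //|Eji].
have /andP[/= ji _] := En _ Eji; rewrite adjC.
have := ad _ Eji; rewrite /= (set_nth_default set0) //.
by rewrite (set_nth_default (out Ps) set0) // (ltn_trans ji).
Qed.

End Fillings.

(** * Colouring tables for K4, K33 and the cube *)

Definition overlay (L : seq (nat * nat * nat)) i j :=
  sumn [seq ((p.1 == (i, j)) || (p.1 == (j, i))) * p.2 | p <- L].

Lemma overlay_symm L : symm (overlay L).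
Proof. by move=> i j; congr sumn; apply: eq_map => p; rewrite orbC. Qed.

Lemma valid3 a b c : valid (a + b + c) ->
  (a, b, c) \in [:: (0, 0, 0); (0, 0, 2); (0, 2, 0); (2, 0, 0);
                    (0, 1, 1); (1, 0, 1); (1, 1, 0)].
Proof. by case: a => [|[|[|a]]]; case: b => [|[|[|b]]]; case: c => [|[|[|c]]]. Qed.

(** In each of the three lists the largest vertex is the outside and [0], [1], [2] are its
    neighbours. In the cube, [6] is opposite to the outside [7]. *)
Definition K4 := [:: (0,1); (0,2); (1,2); (0,3); (1,3); (2,3)].
Definition K33 := [:: (0,3); (0,4); (1,3); (1,4); (2,3); (2,4); (0,5); (1,5); (2,5)].
Definition Q3 := [:: (0,3); (2,3); (0,4); (1,4); (1,5); (2,5); (3,6); (4,6); (5,6);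
  (0,7); (1,7); (2,7)].

(* A table entry q lists the non-tree edges with their colours, and a tree order. *)
Definition checkb n (H : nat -> nat -> bool) (b : nat -> nat) (q : seq (nat * nat * nat) * seq nat) :=
  [&& all (fun i => valid (sumn [seq H i j * overlay q.1 i j | j <- iota 0 n] + b i)) (iota 0 n),
  perm_eq q.2 (iota 0 n) & tree_order H (overlay q.1) q.2].

Definition bd a b c i := nth 0 [:: a; b; c] i.

(** Only the parts [0], [1], [2] can meet the outside, so a boundary colouring is one of the seven
    triples of [valid3] and a table of seven rows settles everything by computation. *)
Lemma fillable_table n (H : nat -> nat -> bool) (tab : nat -> nat -> nat -> seq (nat * nat * nat) * seq nat) : 2 < n ->
  (forall i, 2 < i -> i < n -> ~~ H i n) ->
  all (fun t => checkb n H (bd t.1.1 t.1.2 t.2) (tab t.1.1 t.1.2 t.2))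
    [:: (0, 0, 0); (0, 0, 2); (0, 2, 0); (2, 0, 0); (0, 1, 1); (1, 0, 1); (1, 1, 0)] ->
  fillable n H.
Proof.
move=> n2 nH /allP chk b b0.
have bE i : i < n -> b i = bd (b 0) (b 1) (b 2) i.
  by case: i => [|[|[|i]]] // i_n; rewrite b0 ?nH // /bd /= nth_nil.
have -> : \sum_(0 <= i < n) b i = b 0 + b 1 + b 2.
  case: n n2 nH bE {chk b0} => [|[|[|n]]] // _ nH bE.
  rewrite !big_nat_recl // big1_seq ?addn0 ?addnA // => i.
  by rewrite mem_index_iota => /andP[_ i_n]; rewrite bE // /bd /= nth_nil.
move=> /valid3 /chk /and3P[/= /allP V p t].
set q := tab _ _ _ in V p t; exists (overlay q.1), q.2; split=> //.
  exact: overlay_symm.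
move=> i i_n; have := V i; rewrite mem_iota i_n => /(_ isT).
by rewrite -bE // sumnE big_map /index_iota subn0.
Qed.

Lemma fillable_K4 : fillable 3 (grel K4).
Proof.
(* Among the seven triples only [1, 1, 0] reaches the last branch; likewise in the next two
   tables. *)
pose tab a b c : seq (nat * nat * nat) * seq nat := match a, b, c with
  | 0, 0, 0 => ([:: (0,1,2)], [:: 1; 2; 0])
  | 0, 0, 2 => ([:: (0,1,2)], [:: 1; 2; 0])
  | 0, 1, 1 => ([:: (1,2,1)], [:: 2; 1; 0])
  | 0, 2, 0 => ([:: (0,2,2)], [:: 2; 1; 0])
  | 1, 0, 1 => ([:: (0,2,1)], [:: 2; 1; 0])
  | 2, 0, 0 => ([:: (1,2,2)], [:: 2; 1; 0])
  | _, _, _ => ([:: (0,1,1)], [:: 1; 2; 0])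
  end.
refine (@fillable_table 3 (grel K4) tab isT _ _); last by vm_compute.
by move=> [|[|[|]]].
Qed.

Lemma fillable_K33 : fillable 5 (grel K33).
Proof.
pose tab a b c : seq (nat * nat * nat) * seq nat := match a, b, c with
  | 0, 0, 0 => ([:: (0,3,2); (1,4,2)], [:: 1; 3; 2; 4; 0])
  | 0, 0, 2 => ([:: (0,3,2); (1,4,2)], [:: 1; 3; 2; 4; 0])
  | 0, 1, 1 => ([:: (1,3,1); (2,3,1)], [:: 2; 1; 4; 3; 0])
  | 0, 2, 0 => ([:: (0,3,2); (2,4,2)], [:: 2; 3; 1; 4; 0])
  | 1, 0, 1 => ([:: (0,3,1); (2,3,1)], [:: 3; 2; 1; 4; 0])
  | 2, 0, 0 => ([:: (1,3,2); (2,4,2)], [:: 2; 1; 4; 3; 0])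
  | _, _, _ => ([:: (0,3,1); (1,3,1)], [:: 3; 2; 1; 4; 0])
  end.
refine (@fillable_table 5 (grel K33) tab isT _ _); last by vm_compute.
by move=> [|[|[|[|[|]]]]].
Qed.

Lemma fillable_Q3 : fillable 7 (grel Q3).
Proof.
pose tab a b c : seq (nat * nat * nat) * seq nat := match a, b, c with
  | 0, 0, 0 => ([:: (0,3,2); (1,4,2); (2,5,2)], [:: 2; 3; 1; 5; 6; 4; 0])
  | 0, 0, 2 => ([:: (0,3,2); (1,4,2); (6,5,2)], [:: 1; 5; 2; 3; 6; 4; 0])
  | 0, 1, 1 => ([:: (0,3,2); (1,5,1); (2,5,1)], [:: 2; 3; 5; 6; 1; 4; 0])
  | 0, 2, 0 => ([:: (0,3,2); (2,5,2); (6,4,2)], [:: 2; 3; 6; 5; 1; 4; 0])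
  | 1, 0, 1 => ([:: (0,3,1); (2,3,1); (1,4,2)], [:: 3; 2; 1; 5; 6; 4; 0])
  | 2, 0, 0 => ([:: (2,3,2); (1,5,2); (6,4,2)], [:: 2; 5; 6; 1; 4; 3; 0])
  | _, _, _ => ([:: (2,3,2); (0,4,1); (1,4,1)], [:: 2; 1; 5; 4; 6; 3; 0])
  end.
refine (@fillable_table 7 (grel Q3) tab isT _ _); last by vm_compute.
by move=> [|[|[|[|[|[|[|]]]]]]].
Qed.

Section Patterns.
Variables (T : finType) (e : rel T).
Hypotheses (e_sym : symmetric e) (e_irr : irreflexive e).
Implicit Types (Ps : seq {set T}).

Definition pattern (E : seq (nat * nat)) Ps :=
  [/\ pairwise (fun A B : {set T} => [disjoint A & B]) Ps,
  forall A, A \in Ps -> good e A &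
  all (fun p => adj e (nth set0 Ps p.1) (nth (out Ps) Ps p.2)) E].

Lemma good_K4 Ps : size Ps = 3 -> pattern K4 Ps -> good e (\bigcup_(A <- Ps) A).
Proof.
move=> sz [h1 h2 h3]; apply: (good_pattern e_sym e_irr (E := K4)); rewrite ?sz //.
- by move=> [|[|[|]]] // _; rewrite unlock.
- by rewrite unlock.
- exact: fillable_K4.
Qed.

Lemma good_K33 Ps : size Ps = 5 -> pattern K33 Ps -> good e (\bigcup_(A <- Ps) A).
Proof.
move=> sz [h1 h2 h3]; apply: (good_pattern e_sym e_irr (E := K33)); rewrite ?sz //.
- by move=> [|[|[|[|[|]]]]] // _; rewrite unlock.
- by rewrite unlock.
- exact: fillable_K33.
Qed.

Lemma good_Q3 Ps : size Ps = 7 -> pattern Q3 Ps -> good e (\bigcup_(A <- Ps) A).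
Proof.
move=> sz [h1 h2 h3]; apply: (good_pattern e_sym e_irr (E := Q3)); rewrite ?sz //.
- by move=> [|[|[|[|[|[|[|]]]]]]] // _; rewrite unlock.
- by rewrite unlock.
- exact: fillable_Q3.
Qed.

End Patterns.

(** * Neighbourhoods, components and tree decompositions *)

Section Neighbourhoods.
Variables (T : finType) (e : rel T).
Hypotheses (e_sym : symmetric e) (e_irr : irreflexive e).
Implicit Types (A C D X Z : {set T}).

Definition nbh C := [set y | (y \notin C) && [exists x in C, e x y]].

Definition rest C := ~: (C :|: nbh C).

Definition component A x := [set y | connect [rel u v | [&& e u v, u \in A & v \in A]] x y].

Definition nb v A := \sum_(y in A) e v y.

(* Moving these boundary vertices inside leaves one boundary edge at each vertex of N(C). *)
Definition fat C := C :|: [set s | 1 < nb s C].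

Lemma nbhP C y : reflect (y \notin C /\ exists2 x, x \in C & e x y) (y \in nbh C).
Proof.
rewrite inE; apply: (iffP andP) => [[yC /exists_inP[x xC exy]]|[yC [x xC exy]]].
  by split=> //; exists x.
by split=> //; apply/exists_inP; exists x.
Qed.

Lemma mem_nbh C x y : x \in C -> y \notin C -> e x y -> y \in nbh C.
Proof. by move=> xC yC exy; apply/nbhP; split=> //; exists x. Qed.

Lemma nb_gt0P v A : reflect (exists2 y, y \in A & e v y) (0 < nb v A).
Proof.
rewrite lt0n sum_nat_eq0; apply: (iffP forall_inPn) => -[y yA].
  by case: (boolP (e v y)) => // evy _; exists y.
by move=> evy; exists y; rewrite ?evy.
Qed.

Lemma nbh_nb C s : s \in nbh C -> 0 < nb s C.
Proof. by case/nbhP => _ [x xC exs]; apply/nb_gt0P; exists x; rewrite // e_sym. Qed.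

Lemma nb_nbh C s : s \notin C -> 0 < nb s C -> s \in nbh C.
Proof. by move=> sC /nb_gt0P[x xC esx]; apply: (mem_nbh xC); rewrite // e_sym. Qed.

Lemma nb_eq0 C s : s \notin C -> s \notin nbh C -> nb s C = 0.
Proof.
by move=> sC sN; apply/eqP; rewrite -leqn0 leqNgt; apply: contra sN; apply: nb_nbh.
Qed.

Lemma nb_sub v A A' : A \subset A' -> nb v A <= nb v A'.
Proof.
move=> s; rewrite /nb [X in _ <= X](big_setID A) /= (setIidPr s); exact: leq_addr.
Qed.

Lemma nbU v A A' : [disjoint A & A'] -> nb v (A :|: A') = nb v A + nb v A'.
Proof.
by move=> d; rewrite /nb -bigU //=; apply: eq_bigl => x; rewrite inE.
Qed.

Lemma nb1 v w : nb v [set w] = e v w.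
Proof. by rewrite /nb big_set1. Qed.

Lemma nbU1 v w A : w \notin A -> nb v (w |: A) = e v w + nb v A.
Proof. by move=> wA; rewrite nbU ?disjoints1 // nb1. Qed.

Lemma fat_sub C D : D \subset C -> fat D \subset fat C.
Proof.
move=> s; apply/subsetP => x; rewrite !inE => /orP[/(subsetP s)->//|h].
by rewrite (leq_trans h (nb_sub x s)) orbT.
Qed.

Lemma sub_fat C : C \subset fat C.
Proof. exact: subsetUl. Qed.

Lemma fat_notin C s : s \notin C -> nb s C < 2 -> s \notin fat C.
Proof. by move=> sC h; rewrite !inE negb_or sC -leqNgt. Qed.

Lemma adj_mono A A' D D' : A \subset A' -> D \subset D' -> adj e A D -> adj e A' D'.
Proof.
move=> /subsetP s1 /subsetP s2 /adjP[x [y [xA yD exy]]]; apply/adjP.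
by exists x, y; split; auto.
Qed.

Lemma adj1P x A : reflect (exists2 y, y \in A & e x y) (adj e [set x] A).
Proof.
apply: (iffP (adjP _ _ _)) => [[_ [y [/set1P-> yA exy]]]|[y yA exy]]; first by exists y.
by exists x, y; rewrite inE.
Qed.

Lemma adj_nb x A : adj e [set x] A = (0 < nb x A).
Proof. by apply/adj1P/nb_gt0P. Qed.

Section Components.
Variables (A : {set T}) (x : T).
Hypothesis xA : x \in A.
Let r := [rel u v | [&& e u v, u \in A & v \in A]].

Let r_sym : connect_sym r.
Proof.
by apply: sym_connect_sym => u v; rewrite /= e_sym; congr (_ && _); rewrite andbC.
Qed.

Lemma component_subset : component A x \subset A.
Proof.
apply/subsetP => y; rewrite inE => /(closed_connect (a := mem A)) <- //.
by move=> u v /= /and3P[_ -> ->].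
Qed.

Lemma component_refl : x \in component A x.
Proof. by rewrite inE connect0. Qed.

Lemma component_closed u v : u \in component A x -> v \in A -> e u v -> v \in component A x.
Proof.
move=> uD vA euv; have uA := subsetP component_subset _ uD; move: uD; rewrite !inE => h.
by apply: connect_trans h (connect1 _); rewrite /= euv uA.
Qed.

Lemma component_linked : linked e (component A x).
Proof.
move=> Z ZD /set0Pn[z zZ] ZnD.
case: (boolP [exists u in Z, [exists v in component A x :\: Z, e u v]]) => [|no].
  by case/exists_inP => u uZ /exists_inP[v /setDP[vD vZ] euv]; exists u, v.
case/negP: ZnD; rewrite eqEsubset ZD /=; apply/subsetP => y yD.
have cl : closed r (mem Z).
  apply: intro_closed => // u v /and3P[/= euv uA vA] uZ; apply: contraNT no => vZ.
  apply/exists_inP; exists u => //; apply/exists_inP; exists v => //.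
  by rewrite inE vZ (component_closed _ vA euv) // (subsetP ZD).
suff h : connect r z y by rewrite -(closed_connect cl h).
have := subsetP ZD _ zZ; move: yD; rewrite !inE => xy xz.
by apply: connect_trans xy; rewrite r_sym.
Qed.

End Components.
End Neighbourhoods.

(** * Walks through the tree of a decomposition *)

Section TreeDecomposition.
Variables (T : finType) (e : rel T) (I : finType) (t : rel I) (B : I -> {set T}).
Hypotheses (e_sym : symmetric e) (td : tree_decomposition e t B).

Let avoid i := [rel x y | [&& t x y, x != i & y != i]].

(** Otherwise a path from [a] to [b] avoiding [i] would close to a cycle through [i]. *)
Lemma tree_branch i a b : t i a -> t i b -> connect (avoid i) a b -> a = b.
Proof.
case: td => [[ts ti [_ [_ ac]]] _ _ _] tia tib /connectP[p pp bE].
move: bE tib; case/shortenP: pp => q qq uq _ -> tib {b}.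
case: q qq uq tib => [//|c q] qq uq tib.
have noti l z : path (avoid i) z l -> i \notin l.
  elim: l z => //= y l IH z /andP[/and3P[_ _ yi] /IH]; rewrite inE negb_or => ->.
  by rewrite eq_sym yi.
have ia : i != a by apply: contraTneq tia => <-; rewrite ti.
have sub : subrel (avoid i) t by move=> u v /= /andP[].
have := ac (i :: a :: c :: q) isT.
rewrite cons_uniq inE negb_or ia (noti _ _ qq) => /(_ uq) /negP[].
move: (sub_path sub qq) => pq.
by rewrite (cycle_path i) /= -/(last c q) ts tib tia.
Qed.

Lemma bag_walk v i k m : v \in B k -> v \in B m -> v \notin B i -> connect (avoid i) k m.
Proof.
case: td => _ _ _ h vk vm vi; apply: (connect_sub _ (h v k m vk vm)).
move=> a b /and3P[tab va vb]; apply: connect1; rewrite /= tab /=.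
by apply/andP; split; apply: contraNneq vi => <-.
Qed.

Lemma bags_connected C i l m : linked e C -> [disjoint C & B i] ->
  C :&: B l != set0 -> C :&: B m != set0 -> connect (avoid i) l m.
Proof.
move=> L d /set0Pn[x /setIP[xC xl]] /set0Pn[y /setIP[yC ym]].
pose Z := [set v in C | [exists k, (v \in B k) && connect (avoid i) l k]].
have ZC : Z \subset C by apply/subsetP => v; rewrite inE => /andP[].
have walk v k m' : v \in C -> v \in B k -> v \in B m' -> connect (avoid i) k m'.
  by move=> vC vk vm; apply: bag_walk vk vm _; rewrite (disjointFr d).
case: (eqVneq Z C) => [E|ZnC].
  move: yC; rewrite -E inE => /andP[yC /existsP[k /andP[yk lk]]].
  by apply: connect_trans lk _; apply: walk yk ym.
have Z0 : Z != set0.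
  by apply/set0Pn; exists x; rewrite inE xC; apply/existsP; exists l; rewrite xl connect0.
have [a [b [aZ bC bZ eab]]] := L Z ZC Z0 ZnC.
case: td => _ _ /(_ a b eab) [n /andP[an bn]] _; case/negP: bZ.
move: aZ; rewrite !inE bC => /andP[aC /existsP[k /andP[ak lk]]].
by apply/existsP; exists n; rewrite bn (connect_trans lk) // (walk a).
Qed.

(** Walk from [i] towards a bag that meets [C]. A vertex of [N(C)] shares a bag with a neighbour in
    [C], which lies in the branch the walk enters; hence its bags include the next node, and [N(C)]
    is carried along until [C] is met. *)
Lemma next_bag C i : linked e C -> C != set0 -> nbh e C \subset B i -> [disjoint C & B i] ->
  exists j, nbh e C \subset B j /\ C :&: B j != set0.
Proof.
move=> L C0 Ni dCi; have [[ts ti [_ [tc _]]] cv ce cw] := td.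
have [x xC] := set0Pn _ C0; have [m xm] := cv x.
have m0 : C :&: B m != set0 by apply/set0Pn; exists x; rewrite inE xC.
have /connectP[p pp mE] := tc i m; move: mE m0; case/shortenP: pp => q qq uq _ ->.
elim: q i Ni dCi qq uq => [|a q IH] i Ni dCi /=.
  by move=> _ _; rewrite setI_eq0 dCi.
case/andP=> tia pq /andP[iq uq] last0.
have Na : nbh e C \subset B a.
  apply/subsetP => w wN; have /nbhP[wC [z zC ezw]] := wN.
  have [l /andP[zl wl]] := ce z w ezw.
  have wi : w \in B i := subsetP Ni _ wN.
  have /connectP[p' pp' lE] := cw w i l wi wl.
  move: lE zl; case/shortenP: pp' => p2 {p' wl} pp2 up2 _ -> zl.
  case: p2 pp2 up2 zl => [|b p2] /=; first by move=> _ _ zi; rewrite (disjointFr dCi zC) in zi.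
  case/andP=> /and3P[tib _ wb] pp2 /andP[ib ub] zl.
  have av s z' (r : rel I) : subrel r t -> path r z' s -> i \notin z' :: s -> connect (avoid i) z' (last z' s).
    elim: s z' => [|y s IHs] z' rt /=; first by rewrite connect0.
    case/andP=> /rt tzy ps; rewrite inE negb_or eq_sym => /andP[iz i_ys].
    apply: connect_trans (connect1 _) (IHs y rt ps i_ys).
    by rewrite /= tzy iz; move: i_ys; rewrite inE negb_or eq_sym => /andP[].
  (* [b] is the first step from [i] along the bags of [w]; it and [a] both lie in the branch of the
     bags meeting [C]. *)
  suff -> : a = b by [].
  apply: (tree_branch tia tib).
  have c1 := av q a t (fun _ _ h => h) pq iq.
  have c2 : connect (avoid i) b (last b p2).
    by apply: (av _ _ _ _ pp2 ib) => u v /and3P[].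
  apply: connect_trans c1 _; apply: connect_trans (bags_connected L dCi last0 _) _.
  - apply/set0Pn; exists z; rewrite inE zC; exact: zl.
  - have sa : symmetric (avoid i) by move=> u v; rewrite /= ts [(u != i) && _]andbC.
    by rewrite (sym_connect_sym sa).
case: (boolP (C :&: B a == set0)) => h; last by exists a.
by apply: (IH a Na) => //; rewrite -setI_eq0.
Qed.

End TreeDecomposition.

(** * Lobes of a cubic 3-connected graph *)

Section Cubic.
Variables (T : finType) (e : rel T).
Hypotheses (e_sym : symmetric e) (e_irr : irreflexive e).
Hypotheses (e_cubic : cubic e) (e_conn : k_connected e 3).
Implicit Types (A C D X Z : {set T}).

Lemma nbT v : nb e v setT = 3.
Proof.
rewrite -(e_cubic v) /nb -sum1_card; under eq_bigl do rewrite inE.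
by rewrite big_mkcond [RHS]big_mkcond; apply: eq_bigr => y _; rewrite inE; case: (e v y).
Qed.

Lemma nb_disjoint v A A' : [disjoint A & A'] -> nb e v A + nb e v A' <= 3.
Proof. by move=> d; rewrite -nbU // -(nbT v) nb_sub. Qed.

Lemma nb_all v A : (forall y, e v y -> y \in A) -> nb e v A = 3.
Proof.
move=> h; rewrite -(nbT v) /nb big_mkcond [RHS](eq_bigl xpredT); last by move=> y; rewrite inE.
apply: eq_bigr => y _; case: ifP => // yA; case: (boolP (e v y)) => // /h.
by rewrite yA.
Qed.

Lemma cut_point v : cut e [set v] (~: [set v]) = 3.
Proof.
rewrite cutE -(e_cubic v) -(card_imset (mem [set y | e v y]) (f := pair v)); last by move=> x y [].
apply: eq_card => -[a b]; rewrite inE /=; apply/and3P/imsetP => [[/set1P-> _ h]|[y]].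
  by exists b; rewrite ?inE.
rewrite inE => h [-> ->]; rewrite !inE eqxx h; split=> //.
by apply: contraTneq h => ->; rewrite e_irr.
Qed.

Lemma good1 v : good e [set v].
Proof.
split=> [|c cS cV]; first exact: cut_point.
exists c; split=> //; first by move=> w /set1P ->.
exact: tree_on1.
Qed.

Lemma disjointI A A' : (forall z, z \in A -> z \notin A') -> [disjoint A & A'].
Proof. by move=> h; rewrite disjoint_subset; apply/subsetP. Qed.

Lemma good_K4_union P Q R X : good e P -> good e Q -> good e R ->
  [&& [disjoint P & Q], [disjoint P & R] & [disjoint Q & R]] ->
  \bigcup_(A <- [:: P; Q; R]) A = X ->
  [/\ adj e P Q, adj e P R & adj e Q R] ->
  [/\ adj e P (~: X), adj e Q (~: X) & adj e R (~: X)] ->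
  good e (X).
Proof.
move=> gP gQ gR /and3P[PQ PR QR] E [a1 a2 a3] [b1 b2 b3]; rewrite -E.
apply: (good_K4 e_sym e_irr) => //; split.
- by rewrite /= PQ PR QR.
- by move=> A; rewrite !inE => /or3P[] /eqP->.
- by rewrite /= /out E a1 a2 a3 b1 b2 b3.
Qed.

(** [N(A)] separates [A] from what lies beyond it. *)
Lemma nbh_ge3 A : A != set0 -> rest e A != set0 -> 2 < #|nbh e A|.
Proof.
move=> /set0Pn[a aA] /set0Pn[u]; rewrite !inE negb_or => /andP[uA uN].
rewrite ltnNge; apply/negP => c.
have := e_conn.2 _ c a u; rewrite !inE aA (negbTE uA) /= => /(_ isT).
rewrite (negbTE uA) /= in uN; move/(_ uN) => cau.
have cl : closed [rel x y | [&& e x y, x \in ~: nbh e A & y \in ~: nbh e A]] (mem A).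
  apply: intro_closed.
    apply: sym_connect_sym => x y /=; rewrite e_sym; congr (_ && _); exact: andbC.
  move=> x y /and3P[exy _ yN] xA; apply: contraTT yN => yA.
  by rewrite inE negbK; apply: mem_nbh exy.
by have := closed_connect cl cau; rewrite aA (negbTE uA).
Qed.

(** Otherwise the part beyond [N(C)] would have its whole neighbourhood among the other two vertices
    of [N(C)]. *)
Lemma nb_rest C s : C != set0 -> rest e C != set0 -> #|nbh e C| = 3 -> s \in nbh e C ->
  0 < nb e s (rest e C).
Proof.
move=> C0 R0 N3 sN; rewrite ltnNge; apply/negP; rewrite leqn0 => /eqP z.
have sub : nbh e (rest e C) \subset nbh e C :\ s.
  apply/subsetP => y /nbhP[yR [u uR euy]]; rewrite inE inE; apply/andP; split.
    apply: contraPneq z => ys; apply/eqP; rewrite -lt0n; apply/nb_gt0P; exists u => //.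
    by rewrite -ys e_sym.
  move: yR; rewrite inE negbK inE => /orP[yC|//].
  by move: uR; rewrite !inE negb_or => /andP[uC]; rewrite uC /= => /existsP[]; exists y; rewrite yC e_sym.
have : 2 < #|nbh e (rest e C)|.
  apply: nbh_ge3 => //; have [x xC] := set0Pn _ C0; apply/set0Pn; exists x.
  rewrite inE inE negb_or; apply/andP; split.
    by rewrite !inE xC.
  apply/negP => /(subsetP sub); rewrite !inE xC /=; by rewrite andbF.
move/leq_trans => /(_ _ (subset_leq_card sub)).
by have := cardsD1 s (nbh e C); rewrite sN N3; lia.
Qed.

Variables (I : finType) (t : rel I) (B : I -> {set T}).
Hypotheses (td : tree_decomposition e t B) (B4 : forall i, #|B i| <= 4).

(* A connected set hanging off a bag, with something left beyond its boundary. *)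
Definition lobe C := [/\ C != set0, linked e C, rest e C != set0 &
  exists i, nbh e C \subset B i /\ [disjoint C & B i]].

(** 3-connectivity puts at least three vertices into [N(C)], the next bag holds these and a vertex
    of [C], and it has only four places. *)
Lemma lobe_bag C : lobe C -> #|nbh e C| = 3 /\
  exists j x, x \in C /\ B j = x |: nbh e C.
Proof.
move=> [C0 L R [i [Ni di]]].
have [j [Nj /set0Pn[x /setIP[xC xj]]]] := next_bag td L C0 Ni di.
have sub : x |: nbh e C \subset B j by rewrite subUset sub1set xj.
have xN : x \notin nbh e C by rewrite inE xC.
have := leq_trans (subset_leq_card sub) (B4 j); rewrite cardsU1 xN => c.
have c3 := nbh_ge3 C0 R; split; first by apply/eqP; rewrite eqn_leq c3 -ltnS c.
exists j, x; split=> //; apply/eqP; rewrite eq_sym eqEcard sub cardsU1 xN.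
by apply: leq_trans (B4 j) _; rewrite ltnS.
Qed.

(** The bag [B j] itself contains [N(D)] and avoids [D]. Since [C] is linked, an edge leaves [D]
    inside [C], and it can only end in [x]. *)
Lemma lobe_component C j x y (D := component e (C :\ x) y) : lobe C -> x \in C -> B j = x |: nbh e C ->
  y \in C :\ x -> [/\ lobe D, x \in nbh e D & nbh e D \subset x |: nbh e C].
Proof.
move=> [C0 L R _] xC Bj yC.
have DC : D \subset C :\ x := component_subset e yC.
have yD : y \in D := component_refl _ _ y.
have DCs z : z \in D -> z \in C by move/(subsetP DC); rewrite inE => /andP[].
have xD : x \notin D by apply/negP => /(subsetP DC); rewrite !inE eqxx.
have cl u v : u \in D -> v \in C -> e u v -> v \notin D -> v = x.
  move=> uD vC euv; apply: contraNeq => vx.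
  by apply: component_closed euv; rewrite // !inE vx.
have ND : nbh e D \subset x |: nbh e C.
  apply/subsetP => z /nbhP[zD [u uD euz]]; rewrite in_setU1; case: (boolP (z \in C)) => zC.
    by rewrite (cl u z) ?eqxx.
  by rewrite (mem_nbh (DCs _ uD)) ?orbT.
split=> //.
  split; [by apply/set0Pn; exists y | exact: component_linked | | exists j; rewrite Bj; split=> //].
    have [u] := set0Pn _ R; rewrite inE inE negb_or => /andP[uC uN].
    apply/set0Pn; exists u; rewrite inE inE negb_or; apply/andP; split.
      by apply: contra uC; apply: DCs.
    apply: contra uN => /(subsetP ND); rewrite in_setU1 => /orP[/eqP ux|//].
    by rewrite ux xC in uC.
  rewrite disjoint_subset; apply/subsetP => z zD; rewrite !inE negb_or DCs // andbT.
  by apply: contraNneq xD => <-.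
have [|||u [v [uD vC vD euv]]] := L D.
- by apply/subsetP.
- by apply/set0Pn; exists y.
- by apply: contraNneq xD => ->.
- by rewrite -(cl u v) // (mem_nbh uD).
Qed.

(** * The induction step for a lobe, by the components of C - x *)

Section Lobe.
Variables (C : {set T}) (x : T) (j : I).
Hypotheses (C_lobe : lobe C) (xC : x \in C) (Bj : B j = x |: nbh e C).
Hypothesis IH : forall D, lobe D -> #|D| < #|C| -> good e (fat e D).

Let S := nbh e C.

Definition piece D := exists2 y, y \in C :\ x & D = component e (C :\ x) y.

Lemma S_card : #|S| = 3. Proof. by have [] := lobe_bag C_lobe. Qed.

Lemma S_C s : s \in S -> s \notin C. Proof. by case/nbhP. Qed.

Lemma S_x s : s \in S -> s != x.
Proof. by move/S_C; apply: contraNneq => ->. Qed.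

Lemma S_rest s : s \in S -> 0 < nb e s (rest e C).
Proof.
case: (C_lobe) => C0 _ R _ sS; apply: nb_rest => //; exact: S_card.
Qed.

Lemma S_nb_gt0 s : s \in S -> 0 < nb e s C. Proof. exact: nbh_nb. Qed.

(** One of the three edges at [s] leads beyond [N(C)]. *)
Lemma S_nb_le2 s : s \in S -> nb e s C <= 2.
Proof.
move=> sS; have d : [disjoint C & rest e C].
  by rewrite disjoint_subset; apply/subsetP => z zC; rewrite !inE negbK zC.
have := nb_disjoint s d; have := S_rest sS; lia.
Qed.

Lemma rest_fat : rest e C \subset ~: fat e C.
Proof.
apply/subsetP => u uR; rewrite inE; move: uR; rewrite inE inE negb_or => /andP[uC uN].
by apply: fat_notin => //; rewrite nb_eq0.
Qed.

Lemma S_out s : s \in S -> adj e [set s] (~: fat e C).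
Proof.
move=> /S_rest /nb_gt0P[u uR esu]; apply/adj1P; exists u => //.
exact: (subsetP rest_fat).
Qed.

Lemma S_third s : s \in S -> exists a b, [/\ uniq [:: s; a; b], a \in S, b \in S & S = [set s; a; b]].
Proof.
move=> sS; have : #|S :\ s| == 2 by have := cardsD1 s S; rewrite sS S_card; lia.
case/cards2P => a [b [ab E]].
have [aS as_] : a \in S /\ a != s.
  have : a \in S :\ s by rewrite E !inE eqxx.
  by rewrite !inE => /andP[].
have [bS bs] : b \in S /\ b != s.
  have : b \in S :\ s by rewrite E !inE eqxx orbT.
  by rewrite !inE => /andP[].
exists a, b; split=> //.
  by rewrite /= !inE negb_or eq_sym as_ eq_sym bs ab.
by rewrite -(setD1K sS) E setUA.
Qed.

Lemma nb_x a b c : uniq [:: a; b; c] -> S = [set a; b; c] ->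
  nb e x C + e x a + e x b + e x c = 3.
Proof.
rewrite /= !inE negb_or andbT => /andP[/andP[ab ac] bc] E.
have dCS : [disjoint C & S].
  by rewrite disjoint_sym disjoint_subset; apply/subsetP => s /S_C.
rewrite -(@nb_all x (C :|: S)); last first.
  by move=> y exy; rewrite inE; case: (boolP (y \in C)) => //= yC; apply: mem_nbh exy.
have -> : nb e x (C :|: S) = nb e x C + nb e x S by apply: nbU.
have dc : [disjoint [set a; b] & [set c]].
  by rewrite disjoint_sym disjoints1 !inE negb_or eq_sym ac eq_sym bc.
by rewrite E (nbU _ _ dc) nbU1 ?inE // !nb1 !addnA.
Qed.

Lemma piece_sub D : piece D -> D \subset C :\ x.
Proof. by case=> y yC ->; apply: component_subset. Qed.

Lemma piece_subC D : piece D -> D \subset C.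
Proof. by move/piece_sub/subset_trans; apply; apply: subsetDl. Qed.

Lemma piece_x D : piece D -> x \notin D.
Proof. by move/piece_sub/subsetP => h; apply/negP => /h; rewrite !inE eqxx. Qed.

Lemma piece_S D s : piece D -> s \in S -> s \notin D.
Proof. by move=> pD /S_C; apply: contra => sD; apply: (subsetP (piece_subC pD)). Qed.

Lemma piece_nbh D : piece D -> [/\ lobe D, x \in nbh e D & nbh e D \subset x |: S].
Proof. by case=> y yC ->; apply: (lobe_component C_lobe xC Bj). Qed.

Lemma piece_good D : piece D -> good e (fat e D).
Proof.
move=> pD; have [sD _ _] := piece_nbh pD; apply: IH => //.
have := subset_leq_card (piece_sub pD); rewrite (cardsD1 x C) xC; lia.
Qed.

Lemma piece_nbx D : piece D -> 0 < nb e x D.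
Proof. by move=> /piece_nbh[_ h _]; apply: nbh_nb. Qed.

(** [N(D)] has three vertices, one of them [x], so exactly one vertex of [N(C)] is not seen by
    [D]. *)
Lemma piece_miss D : piece D -> exists s, [/\ s \in S, nb e s D = 0 &
  forall s', s' \in S -> s' != s -> 0 < nb e s' D].
Proof.
move=> pD; have [sD xN NS] := piece_nbh pD; have [N3 _] := lobe_bag sD.
have sub : nbh e D :\ x \subset S.
  by apply/subsetP => z /setD1P[zx /(subsetP NS)]; rewrite in_setU1 (negbTE zx).
have c2 : #|nbh e D :\ x| = 2 by have := cardsD1 x (nbh e D); rewrite xN N3; lia.
have : #|S :\: (nbh e D :\ x)| == 1 by rewrite cardsD (setIidPr sub) c2 S_card.
case/cards1P => s E; exists s.
have : s \in S :\: (nbh e D :\ x) by rewrite E inE.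
rewrite inE => /andP[sN sS]; split=> //.
  apply: nb_eq0 => //; first exact: piece_S.
  by apply: contra sN => h; rewrite inE h inE S_x.
move=> s' s'S s's; apply: nbh_nb => //.
have : s' \notin S :\: (nbh e D :\ x) by rewrite E inE.
by rewrite inE s'S andbT negbK => /setD1P[].
Qed.

Lemma piece_disjoint D D' y : piece D -> piece D' -> y \in D -> y \notin D' -> [disjoint D & D'].
Proof.
case=> a aC -> [b bC ->]; rewrite !inE => ay by_.
have rs : connect_sym [rel u v | [&& e u v, u \in C :\ x & v \in C :\ x]].
  by apply: sym_connect_sym => u v; rewrite /= e_sym; congr (_ && _); rewrite andbC.
rewrite disjoint_subset; apply/subsetP => z; rewrite !inE => az; apply: contra by_ => bz.
by apply: connect_trans bz _; rewrite rs in az; apply: connect_trans az ay.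
Qed.

(** A vertex absorbed by both would have degree at least 4, and a vertex of one piece has no
    neighbour in the other. *)
Lemma piece_fat_disjoint D D' : piece D -> piece D' -> [disjoint D & D'] ->
  [disjoint fat e D & fat e D'].
Proof.
move=> pD pD' d; rewrite disjoint_subset; apply/subsetP => z; rewrite 3!inE => zD.
have key E E' : piece E -> piece E' -> [disjoint E & E'] -> z \in E -> z \notin fat e E'.
  move=> pE pE' dE zE; have zE' : z \notin E' by rewrite (disjointFr dE).
  apply: fat_notin => //; rewrite nb_eq0 //; have [_ _ NS] := piece_nbh pE'.
  apply/negP => /(subsetP NS); rewrite in_setU1 => /orP[/eqP zx|/S_C].
    by move: (piece_x pE); rewrite -zx zE.
  by rewrite (subsetP (piece_subC pE)).
case/orP: zD => [|n1]; first exact: key pD' d.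
apply/negP; rewrite 2!inE => /orP[zD'|n2].
  have := key D' D pD' pD; rewrite disjoint_sym => /(_ d zD').
  by rewrite 2!inE n1 orbT.
by have := nb_disjoint z d; move: n1 n2; lia.
Qed.

(** All neighbours of [s] in [C] lie in [D]. If [D] absorbs [s], the edge from [s] beyond [N(C)] is
    the one wanted; if not, [s] has one neighbour in [C], stays outside, and the edge from [D] to
    [s] serves. *)
Lemma piece_out D s : piece D -> s \in S -> 0 < nb e s D -> nb e s C <= nb e s D ->
  adj e (fat e D) (~: fat e C).
Proof.
move=> pD sS s0 sC; case: (boolP (s \in fat e D)) => sD.
  by apply: adj_mono (S_out sS); rewrite ?sub1set.
have [z zD esz] := nb_gt0P _ _ _ s0; apply/adjP; exists z, s; split.
- exact: (subsetP (sub_fat _ _)).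
- rewrite inE; apply: fat_notin; first exact: S_C.
  by move: sD; rewrite !inE negb_or -leqNgt => /andP[_]; lia.
- by rewrite e_sym.
Qed.

Lemma adj1_fat s D : 0 < nb e s D -> adj e [set s] (fat e D).
Proof. by move=> h; rewrite adj_nb; apply: leq_trans h (nb_sub _ _ (sub_fat _ _)). Qed.

Lemma fat_cover Ps : all (fun A : {set T} => A \subset fat e C) Ps ->
  (forall z, z \in C -> has (fun A : {set T} => z \in A) Ps) ->
  (forall s, s \in S -> 1 < nb e s C -> has (fun A : {set T} => s \in A) Ps) ->
  \bigcup_(A <- Ps) A = fat e C.
Proof.
move=> /allP sub hC hS; apply/setP => z.
have -> : (z \in \bigcup_(A <- Ps) A) = has (fun A : {set T} => z \in A) Ps.
  by elim: (Ps) => [|A Qs IHp]; rewrite ?big_nil ?big_cons !inE // IHp.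
apply/idP/idP => [/hasP[A /sub /subsetP h /h //]|].
case: (boolP (z \in C)) => [/hC //|zC]; rewrite 2!inE (negbTE zC) /= => n1.
by apply: hS => //; apply: nb_nbh => //; apply: leq_trans n1.
Qed.

(** The missed vertex [s] has only [x] as a neighbour in [C]. The edges at [x] therefore go to [s],
    to [a] and once into [D], so [x], [a] and [fat e D] form a triangle. *)
Lemma one_piece_adj D s a b : piece D -> C = x |: D -> uniq [:: s; a; b] -> S = [set s; a; b] ->
  nb e s D = 0 -> 0 < nb e a D -> 0 < nb e b D -> e x a -> good e (fat e C).
Proof.
move=> pD CE us SE s0 a0 b0 xa; have CD v : nb e v C = e v x + nb e v D.
  by rewrite {1}CE nbU1 // piece_x.
have [sS aS bS] : [/\ s \in S, a \in S & b \in S] by rewrite SE !inE !eqxx !orbT.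
have xD := piece_x pD; have x0 := piece_nbx pD.
have deg := nb_x us SE; have := CD x; rewrite e_irr xa in deg *; move=> nxC.
have xs : e x s.
  by have := S_nb_gt0 sS; rewrite CD s0 e_sym; case: (e x s).
rewrite xs in deg.
have xb : e x b = false by move: deg x0; rewrite nxC; case: (e x b) => //=; clear; lia.
have a1 : nb e a D = 1.
  by have := S_nb_le2 aS; move: a0; rewrite CD e_sym xa /=; clear; lia.
apply: (@good_K4_union [set x] [set a] (fat e D)); [exact: good1|exact: good1|exact: piece_good pD|..].
- rewrite !disjoints1 !inE eq_sym S_x //=; apply/andP; split; rewrite negb_or -leqNgt.
    by rewrite xD /=; move: deg; rewrite nxC; clear; lia.
  by rewrite piece_S // a1.
- apply: fat_cover.
  + by rewrite /= !sub1set !(subsetP (sub_fat _ _) _ xC) fat_sub ?piece_subC // inE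
      [a \in [set _ | _]]inE CD e_sym xa a1 orbT.
  + by move=> z; rewrite {1}CE in_setU1 /= !inE => /orP[->|->]; rewrite ?orbT.
  + move=> v; rewrite SE !inE -orbA => /or3P[] /eqP ->.
    * by rewrite CD e_sym xs s0.
    * by rewrite /= !inE eqxx orbT.
    * by rewrite CD e_sym xb /= !inE => ->; rewrite !orbT.
- by split; rewrite ?adj1_fat ?a1 //; apply/adj1P; exists a; rewrite ?inE.
- split; [|exact: S_out|apply: (piece_out pD bS) => //; by rewrite CD e_sym xb].
  apply/adj1P; exists s => //; rewrite inE; apply: fat_notin; first exact: S_C.
  by rewrite CD e_sym xs s0.
Qed.

(** If [x] is adjacent to neither of the vertices seen by [D], two of its edges go into [D]; then
    [D] absorbs [x] and both fat sets coincide. *)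
Lemma one_piece D : piece D -> C = x |: D -> good e (fat e C).
Proof.
move=> pD CE; have CD v : nb e v C = e v x + nb e v D.
  by rewrite {1}CE nbU1 // piece_x.
have [s [sS s0 hit]] := piece_miss pD; have [a [b [us aS bS SE]]] := S_third sS.
have [sa sb] : a != s /\ b != s.
  by move: us; rewrite /= !inE negb_or !(eq_sym s) => /andP[/andP[]].
have [a0 b0] := (hit a aS sa, hit b bS sb).
case: (boolP (e x a)) => xa; first exact: (one_piece_adj pD CE us SE s0 a0 b0 xa).
case: (boolP (e x b)) => xb.
  have us' : uniq [:: s; b; a].
    by move: us; rewrite /= !inE !negb_or !andbT => /andP[/andP[-> ->]]; rewrite eq_sym.
  have SE' : S = [set s; b; a] by rewrite SE setUAC.
  exact: (one_piece_adj pD CE us' SE' s0 b0 a0 xb).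
have xs : e x s.
  by have := S_nb_gt0 sS; rewrite CD s0 e_sym; case: (e x s).
have := nb_x us SE; rewrite CD e_irr xs (negbTE xa) (negbTE xb) => deg.
suff -> : fat e C = fat e D by exact: piece_good pD.
apply/esym; rewrite -(@fat_cover [:: fat e D]) ?big_cons ?big_nil ?setU0 //=.
- by rewrite fat_sub // piece_subC.
- move=> z; rewrite {1}CE in_setU1 !inE orbF => /orP[/eqP->|-> //].
  by apply/orP; right; move: deg; clear => /=; lia.
- move=> v; rewrite SE !inE -orbA orbF => /or3P[] /eqP ->; rewrite CD e_sym.
  + by rewrite xs s0.
  + by rewrite (negbTE xa) => ->; rewrite orbT.
  + by rewrite (negbTE xb) => ->; rewrite orbT.
Qed.

Lemma S_notin_fat s D : piece D -> s \in S -> nb e s D < 2 -> s \notin fat e D.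
Proof. by move=> pD sS; apply: fat_notin; apply: piece_S. Qed.

Lemma x_notin_fat D : piece D -> nb e x D < 2 -> x \notin fat e D.
Proof. by move=> pD; apply: fat_notin; apply: piece_x. Qed.

Lemma in_fat s : s \in C \/ 1 < nb e s C -> s \in fat e C.
Proof. by rewrite !inE => -[->|->] //; rewrite orbT. Qed.

Lemma S_third2 s s' : s \in S -> s' \in S -> s != s' ->
  exists b, [/\ uniq [:: s; s'; b], b \in S & S = [set s; s'; b]].
Proof.
move=> sS s'S ss'; have [a [b [u aS bS SE]]] := S_third sS.
move: s'S ss'; rewrite {1}SE !inE -orbA => /or3P[] /eqP ->; rewrite ?eqxx // => _.
  by exists b.
exists a; split=> //; last by rewrite SE setUAC.
by move: u; rewrite /= !inE !negb_or !andbT => /andP[/andP[-> ->]]; rewrite eq_sym.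
Qed.

Lemma uniq3 (a b c : T) : uniq [:: a; b; c] -> [/\ a != b, a != c & b != c].
Proof. by rewrite /= !inE negb_or andbT => /andP[/andP[]]. Qed.

Section TwoPieces.
Variables D D' : {set T}.
Hypotheses (pD : piece D) (pD' : piece D') (dDD : [disjoint D & D']).
Hypothesis CE : C = x |: (D :|: D').

Lemma nbC2 v : nb e v C = e v x + (nb e v D + nb e v D').
Proof. by rewrite {1}CE nbU1 ?nbU // inE negb_or !piece_x. Qed.

Lemma cover2 z : z \in C -> [|| z == x, z \in D | z \in D'].
Proof. by rewrite {1}CE !inE. Qed.

Let xfC : x \in fat e C. Proof. by apply: in_fat; left. Qed.
Let subD : fat e D \subset fat e C. Proof. by rewrite fat_sub ?piece_subC. Qed.
Let subD' : fat e D' \subset fat e C. Proof. by rewrite fat_sub ?piece_subC. Qed.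

(** K33 with [x], [a], [b] on one side and the two pieces and the outside on the other. The missed
    [s] has only [x] as a neighbour in [C], so it stays outside and provides the edge from [x] to
    the outside. *)
Lemma two_pieces_same_miss s a b : uniq [:: s; a; b] -> S = [set s; a; b] ->
  nb e s D = 0 -> nb e s D' = 0 -> 0 < nb e a D -> 0 < nb e a D' ->
  0 < nb e b D -> 0 < nb e b D' -> good e (fat e C).
Proof.
move=> us SE s1 s2 aD aD' bD bD'; have [sa sb ab] := uniq3 us.
have [sS aS bS] : [/\ s \in S, a \in S & b \in S] by rewrite SE !inE !eqxx !orbT.
have xs : e x s by have := S_nb_gt0 sS; rewrite nbC2 s1 s2 e_sym; case: (e x s).
have deg := nb_x us SE; rewrite nbC2 e_irr xs in deg.
have [xD xD'] : nb e x D = 1 /\ nb e x D' = 1.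
  by move: deg (piece_nbx pD) (piece_nbx pD'); clear => /=; lia.
have one v : v \in S -> 0 < nb e v D -> 0 < nb e v D' ->
    [/\ nb e v D = 1, nb e v D' = 1, 1 < nb e v C & v \in fat e C].
  move=> /S_nb_le2 + h h'; have : 1 < nb e v C by rewrite nbC2; move: h h'; clear; lia.
  by move=> h2; rewrite (in_fat (or_intror h2)) h2 nbC2; move: h h'; clear; case: (e v x) => /=; split; lia.
have [a1 a2 a3 a4] := one a aS aD aD'; have [b1 b2 b3 b4] := one b bS bD bD'.
pose Ps := [:: [set x]; [set a]; [set b]; fat e D; fat e D'].
have E : \bigcup_(A <- Ps) A = fat e C.
  apply: fat_cover.
  - by rewrite /= !sub1set xfC a4 b4 subD subD'.
  - by move=> z /cover2 /or3P[/eqP->|h|h]; rewrite /= !inE ?eqxx ?h ?orbT.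
  - move=> v; rewrite SE !inE -orbA => /or3P[] /eqP ->.
    + by rewrite nbC2 s1 s2; case: (e s x).
    + by rewrite /= !inE eqxx !orbT.
    + by rewrite /= !inE eqxx !orbT.
rewrite -E; apply: (good_K33 e_sym e_irr) => //; split.
- rewrite /= !disjoints1 !inE ![x == _]eq_sym !S_x // (negbTE ab) /= !negb_or -!leqNgt !piece_x //.
  by rewrite !piece_S // xD xD' a1 a2 b1 b2 piece_fat_disjoint.
- move=> A; rewrite !inE => /or4P[| | |/orP[]] /eqP->; try exact: good1; exact: piece_good.
- rewrite /= /out E !adj1_fat ?xD ?xD' ?a1 ?a2 ?b1 ?b2 // (S_out aS) (S_out bS) /= ?andbT.
  apply/adj1P; exists s => //; rewrite inE; apply: fat_notin; first exact: S_C.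
  by rewrite nbC2 s1 s2; case: (e s x).
Qed.

(* Here x, a and fat D collapse to a triangle first; the result, b and fat D' form another. *)
Lemma two_pieces_adj a b c : uniq [:: a; b; c] -> S = [set a; b; c] -> e x a ->
  0 < nb e a D -> nb e a D' = 0 -> 0 < nb e b D -> 0 < nb e b D' ->
  nb e c D = 0 -> 0 < nb e c D' -> good e (fat e C).
Proof.
move=> us SE xa aD aD' bD bD' cD cD'; have [ab ac bc] := uniq3 us.
have [aS bS cS] : [/\ a \in S, b \in S & c \in S] by rewrite SE !inE !eqxx !orbT.
have deg := nb_x us SE; rewrite nbC2 e_irr xa in deg.
(* The three edges at [x] are used up by [a] and one neighbour in each piece. *)
have [xD xD' xb xc] : [/\ nb e x D = 1, nb e x D' = 1, e x b = false & e x c = false].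
  move: deg (piece_nbx pD) (piece_nbx pD'); clear.
  by case: (e x b); case: (e x c) => /=; split; lia.
have a1 : nb e a D = 1.
  by have := S_nb_le2 aS; move: aD; rewrite nbC2 e_sym xa aD' /=; clear; lia.
have [b1 b2] : nb e b D = 1 /\ nb e b D' = 1.
  by have := S_nb_le2 bS; move: bD bD'; rewrite nbC2; clear; lia.
have afC : a \in fat e C by apply: in_fat; right; rewrite nbC2 e_sym xa a1.
have bfC : b \in fat e C by apply: in_fat; right; rewrite nbC2 b1 b2 addnC.
have dF := piece_fat_disjoint pD pD' dDD.
have xfD : x \notin fat e D by rewrite x_notin_fat ?xD.
have xfD' : x \notin fat e D' by rewrite x_notin_fat ?xD'.
have afD : a \notin fat e D by rewrite S_notin_fat ?a1.
have afD' : a \notin fat e D' by rewrite S_notin_fat ?aD'.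
have bfD : b \notin fat e D by rewrite S_notin_fat ?b1.
have bfD' : b \notin fat e D' by rewrite S_notin_fat ?b2.
have xna : x != a by rewrite eq_sym S_x.
have xnb : b != x by rewrite S_x.
pose Y := \bigcup_(A <- [:: [set x]; [set a]; fat e D]) A.
have YE z : (z \in Y) = [|| z == x, z == a | z \in fat e D].
  by rewrite /Y !big_cons big_nil setU0 !in_setU !in_set1.
have bY : b \notin Y by rewrite YE !negb_or xnb eq_sym ab.
have YC : Y \subset fat e C.
  by apply/subsetP => z; rewrite YE => /or3P[/eqP->|/eqP->|/(subsetP subD)].
have xY' : adj e [set x] (~: Y).
  have [z zD' exz] := nb_gt0P _ _ _ (piece_nbx pD'); apply/adj1P; exists z => //.
  have zf := subsetP (sub_fat e D') _ zD'.
  rewrite inE YE !negb_or (disjointFl dF) // andbT.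
  by apply/andP; split; apply: contraTneq zf => ->.
have gY : good e Y.
  apply: (good_K4 e_sym e_irr) => //; split.
  - by rewrite /= !disjoints1 !in_set1 xna xfD afD.
  - move=> A; rewrite !inE => /or3P[] /eqP->; try exact: good1; exact: piece_good.
  - rewrite /= -[out _]/(~: Y) !adj1_fat ?xD ?a1 // xY' ?andbT /=.
    apply/and3P; split.
    + by apply/adj1P; exists a; rewrite ?inE.
    + by apply: adj_mono (S_out aS); rewrite ?setCS.
    + have [z zD ebz] := nb_gt0P _ _ _ bD; apply/adjP; exists z, b; split.
      * exact: (subsetP (sub_fat _ _)).
      * by rewrite inE.
      * by rewrite e_sym.
apply: (@good_K4_union Y [set b] (fat e D')); [exact: gY|exact: good1|exact: piece_good|..].
- rewrite [[disjoint Y & [set b]]]disjoint_sym !disjoints1 bY bfD' andbT /=.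
  apply: disjointI => z; rewrite YE => /or3P[/eqP->|/eqP->|zf] //.
  by rewrite (disjointFr dF).
- apply: fat_cover.
  + by rewrite /= YC sub1set bfC subD'.
  + move=> z /cover2 /or3P[/eqP->|h|h]; rewrite /= YE ?eqxx // !inE h ?orbT //.
  + move=> v; rewrite SE !inE -orbA => /or3P[] /eqP ->.
    * by rewrite /= YE eqxx !orbT.
    * by rewrite /= !inE eqxx !orbT.
    * by rewrite nbC2 e_sym xc cD /= !inE => ->; rewrite !orbT.
- split; last by rewrite adj1_fat ?b2.
    have [z zD ebz] := nb_gt0P _ _ _ bD; apply/adjP; exists z, b; split; rewrite ?inE //.
      by rewrite YE (subsetP (sub_fat _ _) _ zD) !orbT.
    by rewrite e_sym.
  apply: (@adj_mono _ _ [set x] _ (fat e D')) => //; last by rewrite adj1_fat ?xD'.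
  by rewrite sub1set YE eqxx.
- split; [|exact: S_out|].
    by apply: adj_mono (S_out aS); rewrite ?sub1set ?YE ?eqxx ?orbT.
  by apply: (piece_out pD' cS) => //; rewrite nbC2 e_sym xc cD.
Qed.

(** With two neighbours in [D], [x] belongs to [fat e D] and links it to [fat e D']; together with
    [b] these form a triangle. *)
Lemma two_pieces_absorb a b c : uniq [:: a; b; c] -> S = [set a; b; c] ->
  nb e x D = 2 -> nb e x D' = 1 ->
  e x a = false -> e x c = false ->
  0 < nb e a D -> nb e a D' = 0 -> 0 < nb e b D -> 0 < nb e b D' ->
  nb e c D = 0 -> 0 < nb e c D' -> good e (fat e C).
Proof.
move=> us SE xD xD' xa xc aD aD' bD bD' cD cD'.
have [aS bS cS] : [/\ a \in S, b \in S & c \in S] by rewrite SE !inE !eqxx !orbT.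
have [b1 b2] : nb e b D = 1 /\ nb e b D' = 1.
  by have := S_nb_le2 bS; move: bD bD'; rewrite nbC2; clear; lia.
have bfC : b \in fat e C by apply: in_fat; right; rewrite nbC2 b1 b2 addnC.
have dF := piece_fat_disjoint pD pD' dDD.
have xfD : x \in fat e D by rewrite !inE xD orbT.
have bfD : b \notin fat e D by rewrite S_notin_fat ?b1.
have bfD' : b \notin fat e D' by rewrite S_notin_fat ?b2.
apply: (@good_K4_union [set b] (fat e D) (fat e D'));
  [exact: good1|exact: piece_good|exact: piece_good|..].
- by rewrite !disjoints1 bfD bfD'.
- apply: fat_cover.
  + by rewrite /= sub1set bfC subD subD'.
  + by move=> z /cover2 /or3P[/eqP->|h|h]; rewrite /= ?xfD !inE ?h ?orbT.
  + move=> v; rewrite SE !inE -orbA => /or3P[] /eqP ->.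
    * by rewrite nbC2 e_sym xa aD' addn0 /= !inE => ->; rewrite !orbT.
    * by rewrite /= !inE eqxx.
    * by rewrite nbC2 e_sym xc cD /= !inE => ->; rewrite !orbT.
- split; rewrite ?adj1_fat ?b1 ?b2 //.
  apply: (@adj_mono _ _ [set x] _ (fat e D')) => //; last by rewrite adj1_fat ?xD'.
  by rewrite sub1set.
- split; first exact: S_out.
    by apply: (piece_out pD aS) => //; rewrite nbC2 e_sym xa aD' addn0.
  by apply: (piece_out pD' cS) => //; rewrite nbC2 e_sym xc cD.
Qed.

End TwoPieces.

(** If the missed vertices differ, the third vertex [b] sees both pieces, which uses up its edges
    into [C], so it is not adjacent to [x]. When [x] is adjacent to no missed vertex either, its
    three edges split as 2 + 1 between the pieces. *)
Lemma two_pieces D D' : piece D -> piece D' -> [disjoint D & D'] -> C = x |: (D :|: D') ->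
  good e (fat e C).
Proof.
move=> pD pD' d CE; have [s [sS s0 hs]] := piece_miss pD.
have [s' [s'S s'0 hs']] := piece_miss pD'.
case: (eqVneq s s') => [ss|ss].
  have [a [b [us aS bS SE]]] := S_third sS; have [sa sb _] := uniq3 us; rewrite -ss in s'0 hs'.
  by apply: (two_pieces_same_miss pD pD' d CE us SE s0 s'0); auto; first [apply: hs|apply: hs'];
    rewrite // eq_sym.
have [b [us bS SE]] := S_third2 sS s'S ss; have [_ sb s'b] := uniq3 us.
have bD : 0 < nb e b D by apply: hs; rewrite // eq_sym.
have bD' : 0 < nb e b D' by apply: hs'; rewrite // eq_sym.
have s'D : 0 < nb e s' D by apply: hs; rewrite // eq_sym.
have sD' : 0 < nb e s D' by apply: hs'.
have us1 : uniq [:: s; b; s'] by rewrite /= !inE negb_or ss sb [b == s']eq_sym s'b.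
have us2 : uniq [:: s'; b; s] by rewrite /= !inE negb_or s'b [s' == s]eq_sym ss [b == s]eq_sym sb.
have SE1 : S = [set s; b; s'] by rewrite SE setUAC.
have SE2 : S = [set s'; b; s] by rewrite SE [[set s; s']]setUC setUAC.
have d' : [disjoint D' & D] by rewrite disjoint_sym.
have CE' : C = x |: (D' :|: D) by rewrite [D' :|: D]setUC.
case: (boolP (e x s)) => xs; first exact: (two_pieces_adj pD' pD d' CE' us1 SE1).
case: (boolP (e x s')) => xs'; first exact: (two_pieces_adj pD pD' d CE us2 SE2).
have := nb_x us SE; have := S_nb_le2 bS; rewrite !(nbC2 pD pD' d CE).
rewrite e_irr (negbTE xs) (negbTE xs') [e b x]e_sym => h1 h2.
have [[xD xD']|[xD xD']] :
    (nb e x D = 2 /\ nb e x D' = 1) \/ (nb e x D = 1 /\ nb e x D' = 2).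
  by move: h1 h2 bD bD' (piece_nbx pD) (piece_nbx pD'); clear; case: (e x b) => /=; lia.
- by apply: (two_pieces_absorb pD pD' d CE us2 SE2) => //; apply: negbTE.
- by apply: (two_pieces_absorb pD' pD d' CE' us1 SE1) => //; apply: negbTE.
Qed.

(** [D] and [D'] would both see the other two vertices of [N(C)], and [D''] sees at least one of
    these: three neighbours in [C], one too many. *)
Lemma misses_distinct D D' D'' s :
  piece D -> piece D' -> piece D'' ->
  (forall v, nb e v D + nb e v D' + nb e v D'' <= nb e v C) ->
  s \in S -> nb e s D = 0 -> nb e s D' = 0 -> False.
Proof.
move=> pD pD' pD'' le sS sD sD'.
have [a [b [us aS bS _]]] := S_third sS; have [sa sb ab] := uniq3 us.
have hit E v : piece E -> nb e s E = 0 -> v \in S -> s != v -> 0 < nb e v E.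
  move=> pE sE vS sv; have [m [mS m0 hm]] := piece_miss pE.
  case: (eqVneq v m) => [vm|/(hm _ vS) //].
  by have := hm s sS; rewrite sE -vm => /(_ sv).
have [m [mS m0 hm]] := piece_miss pD''.
have key v : v \in S -> s != v -> v != m -> False.
  move=> vS sv vm; have := S_nb_le2 vS; have := le v.
  by move: (hit _ _ pD sD vS sv) (hit _ _ pD' sD' vS sv) (hm v vS vm); clear; lia.
case: (eqVneq a m) => [am|/(key a aS sa) //].
by apply: (key b bS sb); rewrite -am eq_sym.
Qed.

(** Each piece takes one edge of [x] and misses its own vertex of [N(C)]. The remaining incidences
    between pieces and [N(C)] form a 6-cycle, which [x] and the outside complete to a cube. *)
Lemma three_pieces D1 D2 D3 : piece D1 -> piece D2 -> piece D3 ->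
  [disjoint D1 & D2] -> [disjoint D1 & D3] -> [disjoint D2 & D3] ->
  C = x |: (D1 :|: D2 :|: D3) -> good e (fat e C).
Proof.
move=> p1 p2 p3 d12 d13 d23 CE.
have d12_3 : [disjoint D1 :|: D2 & D3].
  by apply: disjointI => z; rewrite inE => /orP[h|h]; [rewrite (disjointFr d13)|rewrite (disjointFr d23)].
have CD v : nb e v C = e v x + (nb e v D1 + nb e v D2 + nb e v D3).
  by rewrite {1}CE nbU1 ?nbU // !inE !negb_or !piece_x.
have [m1 [m1S m11 h1]] := piece_miss p1.
have [m2 [m2S m22 h2]] := piece_miss p2.
have [m3 [m3S m33 h3]] := piece_miss p3.
have m12 : m1 != m2.
  apply/eqP => E; rewrite -E in m22.
  apply: (misses_distinct p1 p2 p3 _ m1S m11 m22) => v; rewrite CD; clear; lia.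
have m13 : m1 != m3.
  apply/eqP => E; rewrite -E in m33.
  apply: (misses_distinct p1 p3 p2 _ m1S m11 m33) => v; rewrite CD; clear; lia.
have m23 : m2 != m3.
  apply/eqP => E; rewrite -E in m33.
  apply: (misses_distinct p2 p3 p1 _ m2S m22 m33) => v; rewrite CD; clear; lia.
have [b [us bS SE]] := S_third2 m1S m2S m12.
have bm : m3 = b.
  have := m3S; rewrite {1}SE !inE -orbA => /or3P[] /eqP E //.
    by rewrite E eqxx in m13.
  by rewrite E eqxx in m23.
rewrite -{b bS}bm in us SE.
have deg := nb_x us SE; rewrite CD e_irr in deg.
have [x1 x2 x3] : [/\ nb e x D1 = 1, nb e x D2 = 1 & nb e x D3 = 1].
  by move: deg (piece_nbx p1) (piece_nbx p2) (piece_nbx p3); clear => /=; split; lia.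
have [x1' x2' x3'] : [/\ x \notin fat e D1, x \notin fat e D2 & x \notin fat e D3].
  by rewrite !x_notin_fat ?x1 ?x2 ?x3.
have [[m1D2 m1D3] [m2D1 m2D3] [m3D1 m3D2]] : [/\ nb e m1 D2 = 1 /\ nb e m1 D3 = 1,
    nb e m2 D1 = 1 /\ nb e m2 D3 = 1 & nb e m3 D1 = 1 /\ nb e m3 D2 = 1].
  have := S_nb_le2 m1S; have := S_nb_le2 m2S; have := S_nb_le2 m3S.
  rewrite !CD; have := h2 _ m1S m12; have := h3 _ m1S m13; have := h3 _ m2S m23.
  have := h1 m2 m2S; have := h1 m3 m3S; have := h2 m3 m3S; rewrite ![_ == m1]eq_sym [_ == m2]eq_sym.
  move=> /(_ m23) + /(_ m13) + /(_ m12); clear; split; lia.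
have [f1 f2 f3] : [/\ m1 \in fat e C, m2 \in fat e C & m3 \in fat e C].
  by split; apply: in_fat; right; rewrite CD ?m1D2 ?m1D3 ?m2D1 ?m2D3 ?m3D1 ?m3D2; clear; lia.
have [m1f1 m1f2 m1f3] : [/\ m1 \notin fat e D1, m1 \notin fat e D2 & m1 \notin fat e D3].
  by rewrite !S_notin_fat ?m1D2 ?m1D3 ?m11.
have [m2f1 m2f2 m2f3] : [/\ m2 \notin fat e D1, m2 \notin fat e D2 & m2 \notin fat e D3].
  by rewrite !S_notin_fat ?m2D1 ?m2D3 ?m22.
have [m3f1 m3f2 m3f3] : [/\ m3 \notin fat e D1, m3 \notin fat e D2 & m3 \notin fat e D3].
  by rewrite !S_notin_fat ?m3D1 ?m3D2 ?m33.
have F12 := piece_fat_disjoint p1 p2 d12.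
have F13 := piece_fat_disjoint p1 p3 d13.
have F23 := piece_fat_disjoint p2 p3 d23.
(* The order follows [Q3]: part 3 must see parts 0 and 2, part 4 parts 0 and 1, part 5 parts 1 and
   2, whence [D2], [D3], [D1]. *)
pose Ps := [:: [set m1]; [set m2]; [set m3]; fat e D2; fat e D3; fat e D1; [set x]].
have E : \bigcup_(A <- Ps) A = fat e C.
  apply: fat_cover.
  - rewrite /= !sub1set f1 f2 f3 !fat_sub ?piece_subC // !andbT.
    by apply: in_fat; left.
  - move=> z; rewrite {1}CE !inE => /orP[/eqP->|/orP[/orP[]|] h]; rewrite /= !inE ?eqxx ?h ?orbT //.
  - by move=> v; rewrite SE !inE -orbA => /or3P[] /eqP -> _; rewrite /= !inE eqxx ?orbT.
rewrite -E; apply: (good_Q3 e_sym e_irr) => //; split.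
- rewrite /= !disjoints1 ![[disjoint _ & [set x]]]disjoint_sym !disjoints1 !in_set1.
  rewrite !S_x //.
  rewrite m12 m13 m23 m1f1 m1f2 m1f3 m2f1 m2f2 m2f3 m3f1 m3f2 m3f3 x1' x2' x3'.
  by rewrite F23 [[disjoint fat e D2 & fat e D1]]disjoint_sym F12 disjoint_sym F13.
- by move=> A; rewrite !inE; do 6! (case/orP; first by move/eqP->; (exact: good1 || exact: piece_good));
    move/eqP->; exact: good1.
- rewrite /= /out E !adj1_fat ?m1D2 ?m1D3 ?m2D1 ?m2D3 ?m3D1 ?m3D2 // (S_out m1S) (S_out m2S) (S_out m3S).
  by rewrite ![adj e (fat e _) [set x]]adjC // !adj1_fat ?x1 ?x2 ?x3.
Qed.

Lemma not_subset A A' : ~~ (A \subset A') -> exists2 y, y \in A & y \notin A'.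
Proof. by case/subsetPn => y; exists y. Qed.

Lemma good_lobe_step : good e (fat e C).
Proof.
have pieceC y : y \in C -> y != x -> exists D, piece D /\ y \in D.
  move=> yC yx; exists (component e (C :\ x) y); split; last exact: component_refl.
  by exists y; rewrite // !inE yx.
have eqC A : A \subset C -> C \subset x |: A -> C = x |: A.
  by move=> AC CA; apply/eqP; rewrite eqEsubset CA subUset sub1set xC.
case: (boolP (C \subset x |: set0)) => [/(eqC _ (sub0set _))|/not_subset[y1 y1C]].
  rewrite setU0 => CE; suff -> : fat e C = [set x] by exact: good1.
  rewrite -(@fat_cover [:: [set x]]) ?big_cons ?big_nil ?setU0 //=.
  - by rewrite CE sub_fat.
  - by move=> z; rewrite CE => ->.
  - by move=> s _; rewrite CE nb1; case: (e s x).
rewrite in_setU1 inE orbF => y1x; have [D1 [p1 y1D]] := pieceC _ y1C y1x.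
have s1 := piece_subC p1.
case: (boolP (C \subset x |: D1)) => [/(eqC _ s1)/(one_piece p1) //|/not_subset[y2 y2C]].
rewrite in_setU1 negb_or => /andP[y2x y2D1]; have [D2 [p2 y2D]] := pieceC _ y2C y2x.
have d21 := piece_disjoint p2 p1 y2D y2D1; have s2 := piece_subC p2.
have d12 : [disjoint D1 & D2] by rewrite disjoint_sym.
have s12 : D1 :|: D2 \subset C by rewrite subUset s1.
case: (boolP (C \subset x |: (D1 :|: D2))) => [/(eqC _ s12)/(two_pieces p1 p2 d12) //|].
case/not_subset => y3 y3C; rewrite in_setU1 in_setU !negb_or => /and3P[y3x y3D1 y3D2].
have [D3 [p3 y3D]] := pieceC _ y3C y3x; have s3 := piece_subC p3.
have d31 := piece_disjoint p3 p1 y3D y3D1; have d32 := piece_disjoint p3 p2 y3D y3D2.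
have d13 : [disjoint D1 & D3] by rewrite disjoint_sym.
have d23 : [disjoint D2 & D3] by rewrite disjoint_sym.
have s123 : D1 :|: D2 :|: D3 \subset C by rewrite subUset s12.
case: (boolP (C \subset x |: (D1 :|: D2 :|: D3))) => [/(eqC _ s123)|].
  exact: three_pieces p1 p2 p3 d12 d13 d23.
case/not_subset => y4 y4C; rewrite in_setU1 !in_setU !negb_or -!andbA => /and4P[y4x y4D1 y4D2 y4D3].
have [D4 [p4 y4D]] := pieceC _ y4C y4x.
have d41 := piece_disjoint p4 p1 y4D y4D1; have d42 := piece_disjoint p4 p2 y4D y4D2.
have d43 := piece_disjoint p4 p3 y4D y4D3.
(* Four disjoint pieces would need four edges at [x]. *)
have d : [disjoint D1 :|: D2 & D3 :|: D4].
  apply: disjointI => z; rewrite !inE negb_or => /orP[h|h].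
    by rewrite (disjointFr d13 h) (disjointFl d41 h).
  by rewrite (disjointFr d23 h) (disjointFl d42 h).
have := nb_disjoint x d; rewrite !nbU // 1?disjoint_sym //.
by move: (piece_nbx p1) (piece_nbx p2) (piece_nbx p3) (piece_nbx p4); clear; lia.
Qed.

End Lobe.

Lemma lobe_good C : lobe C -> good e (fat e C).
Proof.
have [n] := ubnP #|C|; elim: n C => // n IH C Cn sC.
have [_ [j [x [xC Bj]]]] := lobe_bag sC.
apply: (good_lobe_step sC xC Bj) => D sD DC; apply: IH => //.
by move: Cn DC; clear; lia.
Qed.

Lemma full_bag C : lobe C -> exists v j, B j = v |: nbh e [set v].
Proof.
have [n] := ubnP #|C|; elim: n C => // n IH C Cn sC.
have [_ [j [x [xC Bj]]]] := lobe_bag sC.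
case: (boolP (C \subset [set x])) => [Cx|/not_subset[y yC yx]].
  have CE : C = [set x] by apply/eqP; rewrite eqEsubset Cx sub1set.
  by exists x, j; rewrite Bj CE.
have yC' : y \in C :\ x by rewrite inE yx.
have [sD _ _] := lobe_component sC xC Bj yC'; apply: IH sD.
have := subset_leq_card (component_subset e yC'); move: Cn; rewrite (cardsD1 x C) xC.
by clear; lia.
Qed.

(** The point is that something lies beyond [N(D)]: the next bag holds [N(D)] and a vertex of [D],
    so [N(D)] has at most three vertices and cannot cover the four of [B i]. *)
Lemma component_lobe i y : #|B i| = 4 -> y \notin B i -> lobe (component e (~: B i) y).
Proof.
move=> Bi yB; have yB' : y \in ~: B i by rewrite inE.
set D := component e _ y; have DB : D \subset ~: B i := component_subset e yB'.
have L : linked e D := component_linked e_sym yB'.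
have D0 : D != set0 by apply/set0Pn; exists y; apply: component_refl.
have dD : [disjoint D & B i] by apply: disjointI => z /(subsetP DB); rewrite inE.
have NB : nbh e D \subset B i.
  apply/subsetP => z /nbhP[zD [u uD euz]]; apply: contraNT zD => zB.
  by apply: component_closed euz; rewrite // inE.
split=> //; last by exists i.
have [j [Nj /set0Pn[w /setIP[wD wj]]]] := next_bag td L D0 NB dD.
have sub : w |: nbh e D \subset B j by rewrite subUset sub1set wj.
have := leq_trans (subset_leq_card sub) (B4 j).
have wN : w \notin nbh e D by rewrite inE wD.
rewrite cardsU1 wN => N4.
have /not_subset[z zB zN] : ~~ (B i \subset nbh e D).
  by apply/negP => /subset_leq_card; rewrite Bi; move: N4; clear; lia.
by apply/set0Pn; exists z; rewrite !in_setC in_setU negb_or (disjointFl dD zB).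
Qed.

(** * The complement of a vertex whose closed neighbourhood is a bag *)

Section Top.
Variables (v : T) (j : I).
Hypothesis Bj : B j = v |: nbh e [set v].
Let N := nbh e [set v].

Lemma mem_N y : (y \in N) = e v y.
Proof.
apply/nbhP/idP => [[_ [x /set1P->]] //|vy]; split; last by exists v; rewrite ?inE.
by rewrite inE; apply: contraTneq vy => ->; rewrite e_irr.
Qed.

Lemma N_card : #|N| = 3.
Proof. by rewrite -(e_cubic v); apply: eq_card => y; rewrite mem_N inE. Qed.

Lemma v_N : v \notin N. Proof. by rewrite mem_N e_irr. Qed.

Lemma N_v s : s \in N -> s != v. Proof. by apply: contraTneq => ->; exact: v_N. Qed.

Lemma Bj_card : #|B j| = 4. Proof. by rewrite Bj cardsU1 v_N N_card. Qed.

Lemma N_out s : s \in N -> adj e [set s] (~: [set~ v]).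
Proof. by rewrite mem_N => vs; apply/adj1P; exists v; rewrite ?inE ?negbK // e_sym. Qed.

Definition side D := exists2 y, y \notin B j & D = component e (~: B j) y.

Lemma side_notin D z : side D -> z \in D -> z \notin B j.
Proof.
by case=> y yB -> /(subsetP (component_subset e _)); rewrite !inE => ->.
Qed.

Lemma side_v D : side D -> v \notin D.
Proof. by move=> sD; apply/negP => /(side_notin sD); rewrite Bj !inE eqxx. Qed.

Lemma side_N D s : side D -> s \in N -> s \notin D.
Proof. by move=> sD sN; apply/negP => /(side_notin sD); rewrite Bj in_setU1 sN orbT. Qed.

Lemma side_lobe D : side D -> lobe D.
Proof. by case=> y yB ->; apply: component_lobe Bj_card yB. Qed.

(** [N(D)] has three vertices, lies in the bag and avoids [v], whose neighbours all belong to
    [N]. *)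
Lemma side_nbh D : side D -> nbh e D = N.
Proof.
move=> sD; have [N3 _] := lobe_bag (side_lobe sD).
apply/eqP; rewrite eqEcard N3 N_card leqnn andbT; apply/subsetP => z /nbhP[zD [u uD euz]].
have zB : z \in B j.
  case: (sD) zD uD => y yB -> zD uD; apply: contraNT zD => zB.
  by apply: component_closed euz; rewrite // inE.
move: zB; rewrite Bj in_setU1 => /orP[/eqP zv|//].
have := side_N sD (s := u); rewrite uD mem_N -zv e_sym euz => /(_ isT); by [].
Qed.

Lemma side_nb D s : side D -> s \in N -> 0 < nb e s D.
Proof. by move=> /side_nbh <-; apply: nbh_nb. Qed.

Lemma side_good D : side D -> good e (fat e D).
Proof. by move/side_lobe/lobe_good. Qed.

Lemma side_vfat D : side D -> v \notin fat e D.
Proof.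
move=> sD; apply: fat_notin; first exact: side_v.
rewrite nb_eq0 //; first exact: side_v.
rewrite side_nbh //; exact: v_N.
Qed.

Lemma side_disjoint D D' y : side D -> side D' -> y \in D -> y \notin D' -> [disjoint D & D'].
Proof.
case=> a _ -> [b _ ->]; rewrite !inE => ay by_.
have rs : connect_sym [rel u w | [&& e u w, u \in ~: B j & w \in ~: B j]].
  by apply: sym_connect_sym => u w; rewrite /= e_sym; congr (_ && _); rewrite andbC.
apply: disjointI => z; rewrite !inE => az; apply: contra by_ => bz.
by apply: connect_trans bz _; rewrite rs in az; apply: connect_trans az ay.
Qed.

Lemma N3 : exists a b c, uniq [:: a; b; c] /\ N = [set a; b; c].
Proof.
have /card_gt0P[c cN] : 0 < #|N| by rewrite N_card.
have : #|N :\ c| == 2 by have := cardsD1 c N; rewrite cN N_card; clear; lia.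
case/cards2P => a [b [ab E]].
have : a \in N :\ c by rewrite E !inE eqxx.
have : b \in N :\ c by rewrite E !inE eqxx orbT.
rewrite !in_setD1 => /andP[bc _] /andP[ac _]; exists a, b, c; split.
  by rewrite /= !inE negb_or ab ac bc.
by rewrite -(setD1K cN) E setUC.
Qed.

Lemma nb_N s : s \in N -> nb e s N + nb e s (~: B j) = 2.
Proof.
move=> sN; have vs : e v s by rewrite -mem_N.
have d : [disjoint B j & ~: B j] by apply: disjointI => z; rewrite inE negbK.
have := nbT s; rewrite -(setUCr (B j)) nbU // Bj nbU1 ?v_N // e_sym vs -Bj -/N /=.
by clear; lia.
Qed.

Lemma nb_set3 s a b c : uniq [:: a; b; c] -> nb e s [set a; b; c] = e s a + e s b + e s c.
Proof.
case/uniq3 => ab ac bc.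
have dc : [disjoint [set a; b] & [set c]].
  by rewrite disjoint_sym disjoints1 !inE negb_or eq_sym ac eq_sym bc.
by rewrite (nbU _ _ dc) nbU1 ?inE // !nb1.
Qed.

Lemma cover1 Ps : all (fun A : {set T} => v \notin A) Ps ->
  (forall z, z != v -> has (fun A : {set T} => z \in A) Ps) ->
  \bigcup_(A <- Ps) A = [set~ v].
Proof.
move=> /allP sub h; apply/setP => z.
have -> : (z \in \bigcup_(A <- Ps) A) = has (fun A : {set T} => z \in A) Ps.
  by elim: (Ps) => [|A Qs IHp]; rewrite ?big_nil ?big_cons !inE // IHp.
rewrite !inE; case: (eqVneq z v) => [->|/h //].
by apply/hasP => -[A /sub /negP].
Qed.

Lemma notBj z : z != v -> z \in N \/ z \notin B j.
Proof.
by move=> zv; rewrite Bj in_setU1 (negbTE zv) /=; case: (boolP (z \in N)); [left|right].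
Qed.

Lemma side_out D s : side D -> s \in N -> 1 < nb e s D -> adj e (fat e D) (~: [set~ v]).
Proof.
move=> sD sN h; apply/adjP; exists s, v; split; last by rewrite e_sym -mem_N.
  by rewrite !inE h orbT.
by rewrite !inE negbK.
Qed.

(** Besides their edges to [v] and to each other, [a] and [b] have just one edge, and it goes into
    [D]. So [c] is adjacent to neither and has two neighbours in [D], which absorbs it; [a], [b] and
    [fat e D] form a triangle. *)
Lemma one_side a b c D : side D -> ~: B j \subset D -> uniq [:: a; b; c] -> N = [set a; b; c] ->
  nb e a D < 2 -> e a b -> good e [set~ v].
Proof.
move=> sD WD us NE a1 ab.
have WE : ~: B j = D.
  apply/eqP; rewrite eqEsubset WD; apply/subsetP => z /(side_notin sD).
  by rewrite inE.
have [nab nac nbc] := uniq3 us.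
have [aN bN cN] : [/\ a \in N, b \in N & c \in N] by rewrite NE !inE !eqxx !orbT.
have := nb_N aN; have := nb_N bN; have := nb_N cN.
rewrite WE NE !nb_set3 // !e_irr ab [e b a]e_sym ab [e c a]e_sym [e c b]e_sym.
have [a0 b0 c0] := And3 (side_nb sD aN) (side_nb sD bN) (side_nb sD cN).
move=> h1 h2 h3; have [b1 c2] : nb e b D < 2 /\ 1 < nb e c D.
  by move: h1 h2 h3 a0 b0 c0; clear; case: (e a c); case: (e b c) => /=; lia.
apply: (good_K4_union (P := [set a]) (Q := [set b]) (R := fat e D)).
- exact: good1.
- exact: good1.
- exact: side_good.
- by rewrite !disjoints1 inE nab !fat_notin ?(side_N sD).
- apply: cover1.
    by rewrite /= !in_set1 ![v == _]eq_sym !N_v //= side_vfat.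
  move=> z /notBj[|]; last first.
    by rewrite -in_setC WE /= => zD; rewrite (subsetP (sub_fat _ _) _ zD) !orbT.
  by rewrite NE !inE -orbA => /or3P[] /eqP->; rewrite /= !inE ?eqxx ?c2 ?orbT.
- by split; rewrite ?adj1_fat //; apply/adj1P; exists b; rewrite ?inE.
- split; [exact: N_out|exact: N_out|exact: side_out cN c2].
Qed.

(** A vertex of [N] spends one edge on [v] and at least one on each component outside the bag, so
    there are at most two components. With none the graph is K4; with one, either it absorbs all of
    [N] or two vertices of [N] are adjacent; with two, [v] is the sixth vertex of a K33. *)
Lemma good_top : good e [set~ v].
Proof.
have [a [b [c [us NE]]]] := N3; have [nab nac nbc] := uniq3 us.
have [aN bN cN] : [/\ a \in N, b \in N & c \in N] by rewrite NE !inE !eqxx !orbT.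
have := And3 (nb_N aN) (nb_N bN) (nb_N cN).
rewrite NE !nb_set3 // !e_irr [e b a]e_sym [e c a]e_sym [e c b]e_sym => -[ha hb hc].
case: (boolP (~: B j \subset set0)) => [|/not_subset[y1]].
  rewrite subset0 => /eqP W0; rewrite W0 /nb !big_set0 in ha hb hc.
  have [ab ac bc] : [/\ e a b, e a c & e b c].
    by move: ha hb hc; clear; case: (e a b); case: (e a c); case: (e b c).
  apply: (good_K4_union (P := [set a]) (Q := [set b]) (R := [set c]));
    try exact: good1.
  - by rewrite !disjoints1 !in_set1 nab nac nbc.
  - apply: cover1; first by rewrite /= !in_set1 ![v == _]eq_sym !N_v.
    move=> z /notBj[|]; last by rewrite -in_setC W0 inE.
    by rewrite NE !inE -orbA => /or3P[] /eqP->; rewrite /= !inE ?eqxx ?orbT.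
  - by rewrite !adj_nb !nb1 ab ac bc.
  - by rewrite !N_out.
rewrite inE => y1B _; pose D := component e (~: B j) y1.
have sD : side D by exists y1.
have [a0 b0 c0] := And3 (side_nb sD aN) (side_nb sD bN) (side_nb sD cN).
case: (boolP (~: B j \subset D)) => [WD|/not_subset[y2]].
  have WE : ~: B j = D.
    apply/eqP; rewrite eqEsubset WD; apply/subsetP => z /(side_notin sD).
    by rewrite inE.
  case: (boolP [&& 1 < nb e a D, 1 < nb e b D & 1 < nb e c D]) => [/and3P[a2 b2 c2]|].
    suff <- : fat e D = [set~ v] by exact: side_good.
    rewrite -(@cover1 [:: fat e D]) ?big_cons ?big_nil ?setU0 //=; first by rewrite side_vfat.
    move=> z /notBj[|]; last first.
      by rewrite -in_setC WE => zD; rewrite (subsetP (sub_fat _ _) _ zD).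
    by rewrite NE !inE orbF -orbA => /or3P[] /eqP->; rewrite ?a2 ?b2 ?c2 orbT.
  rewrite WE in ha hb hc => n1.
  (* A vertex of [N] with only one neighbour in [D] has its third edge inside [N]. *)
  have : [\/ nb e a D < 2 /\ e a b, nb e a D < 2 /\ e a c | nb e b D < 2 /\ e b c].
    move: n1 ha hb hc a0 b0 c0; clear.
    case: (e a b); case: (e a c); case: (e b c) => /= n1 ha hb hc a0 b0 c0;
      first [by constructor 1; split=> //; lia | by constructor 2; split=> //; lia
        | by constructor 3; split=> //; lia | exfalso; lia].
  case=> -[h1 h2].
  - exact: (one_side sD WD us NE h1 h2).
  - apply: (one_side sD WD (c := b) _ _ h1 h2); last by rewrite NE setUAC.
    by rewrite /= !inE negb_or nab nac [c == b]eq_sym nbc.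
  - apply: (one_side sD WD (c := a) _ _ h1 h2); last by rewrite NE -setUA setUC.
    by rewrite /= !inE negb_or nbc [b == a]eq_sym nab [c == a]eq_sym nac.
rewrite inE => y2B y2D; pose D' := component e (~: B j) y2.
have sD' : side D' by exists y2.
have y2D' : y2 \in D' by apply: component_refl.
have d' : [disjoint D' & D] := side_disjoint sD' sD y2D' y2D.
have d : [disjoint D & D'] by rewrite disjoint_sym.
have [a0' b0' c0'] := And3 (side_nb sD' aN) (side_nb sD' bN) (side_nb sD' cN).
have sub : D :|: D' \subset ~: B j.
  by apply/subsetP => z; rewrite inE => /orP[/(side_notin sD)|/(side_notin sD')]; rewrite inE.
have le s : nb e s D + nb e s D' <= nb e s (~: B j) by rewrite -nbU // nb_sub.
have [a1 b1 c1] : [/\ nb e a D = 1 /\ nb e a D' = 1, nb e b D = 1 /\ nb e b D' = 1 &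
    nb e c D = 1 /\ nb e c D' = 1].
  by move: ha hb hc (le a) (le b) (le c) a0 b0 c0 a0' b0' c0'; clear; split; lia.
have WE : ~: B j \subset D :|: D'.
  apply/negP => /negP /not_subset[y3]; rewrite inE => y3B; rewrite inE negb_or => /andP[y3D y3D'].
  pose D'' := component e (~: B j) y3; have sD'' : side D'' by exists y3.
  have y3D'' : y3 \in D'' by apply: component_refl.
  have d1 := side_disjoint sD'' sD y3D'' y3D; have d2 := side_disjoint sD'' sD' y3D'' y3D'.
  have dd : [disjoint D :|: D' & D''].
    by apply: disjointI => z; rewrite inE => /orP[h|h]; [rewrite (disjointFl d1)|rewrite (disjointFl d2)].
  have sub2 : D :|: D' :|: D'' \subset ~: B j.
    by rewrite subUset sub; apply/subsetP => z /(side_notin sD''); rewrite inE.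
  have := nb_sub e a sub2; rewrite !nbU //.
  by have := side_nb sD'' aN; move: ha a1.1 a1.2; clear; lia.
case: a1 b1 c1 => a1 a1' [b1 b1'] [c1 c1'].
pose Ps := [:: [set a]; [set b]; [set c]; fat e D; fat e D'].
have E : \bigcup_(A <- Ps) A = [set~ v].
  apply: cover1; first by rewrite /= !in_set1 ![v == _]eq_sym !N_v ?side_vfat.
  move=> z /notBj[|]; last first.
    rewrite -in_setC => /(subsetP WE); rewrite in_setU => /orP[h|h] /=;
    by rewrite (subsetP (sub_fat _ _) _ h) !orbT.
  by rewrite NE !inE -orbA => /or3P[] /eqP->; rewrite /= !inE ?eqxx ?orbT.
have F s A : side A -> s \in N -> nb e s A = 1 -> s \notin fat e A.
  by move=> sA sN n1; rewrite fat_notin ?n1 ?side_N.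
have dF : [disjoint fat e D & fat e D'].
  apply: disjointI => z zD; apply/negP => zD'.
  case: (boolP (z \in N)) => zN.
    move: zN; rewrite NE !in_setU !in_set1 -orbA => /or3P[] /eqP zE; move: zD; rewrite zE;
      by apply/negP; apply: F.
  have inA A : side A -> z \in fat e A -> z \in A.
    move=> sA zA; apply: contraTT zA => zA; apply: fat_notin => //.
    by rewrite nb_eq0 // side_nbh.
  by have := inA _ sD' zD'; rewrite (disjointFr d) // inA.
rewrite -E; apply: (good_K33 e_sym e_irr) => //; split.
- by rewrite /= !disjoints1 !in_set1 nab nac nbc !F // dF.
- move=> A; rewrite !inE => /or4P[| | |/orP[]] /eqP->; try exact: good1; exact: side_good.
- by rewrite /= /out E !adj1_fat // !N_out.
Qed.

End Top.

Lemma good_point : (exists i, #|B i| = 4) -> exists v, good e [set~ v].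
Proof.
case=> i Bi.
case: (boolP (setT \subset B i)) => [BT|/not_subset[y _ yB]]; last first.
  have [v [j Bj]] := full_bag (component_lobe Bi yB); exists v; exact: (good_top Bj).
(* The graph has only four vertices, and any vertex will do. *)
have BE : B i = setT by apply/eqP; rewrite eqEsubset subsetT.
have /card_gt0P[v _] : 0 < #|B i| by rewrite Bi.
exists v; apply: (@good_top v i); apply/esym/eqP.
rewrite eqEcard BE subsetT -BE Bi cardsU1.
have -> : v \notin nbh e [set v] by rewrite inE inE eqxx.
have -> : nbh e [set v] = [set y | e v y] by apply/setP => y; rewrite mem_N inE.
by rewrite e_cubic.
Qed.

End Cubic.

(** * From colourings to 3-decompositions *)

Section Decomposition.
Variables (T : finType) (e : rel T).
Hypotheses (e_sym : symmetric e) (e_irr : irreflexive e) (e_cubic : cubic e).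

Definition color_class (c : T -> T -> nat) k : {set {set T}} :=
  [set [set x; y] | x in T, y in T & e x y && (c x y == k)].

Lemma set2_eq (x y a b : T) : [set x; y] = [set a; b] ->
  (x = a /\ y = b) \/ (x = b /\ y = a).
Proof.
move=> E; have : x \in [set a; b] by rewrite -E !inE eqxx.
have : y \in [set a; b] by rewrite -E !inE eqxx orbT.
have : a \in [set x; y] by rewrite E !inE eqxx.
have : b \in [set x; y] by rewrite E !inE eqxx orbT.
rewrite !inE => /orP[]/eqP h1 /orP[]/eqP h2 /orP[]/eqP h3 /orP[]/eqP h4; subst; auto.
Qed.

Lemma color_classP c k x y : symm c ->
  ([set x; y] \in color_class c k) = e x y && (c x y == k).
Proof.
move=> cS; apply/imset2P/idP => [[a b _]|h]; last by exists x y; rewrite ?inE.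
by rewrite !inE => h /set2_eq[[-> ->] //|[-> ->]]; rewrite e_sym cS.
Qed.

Lemma deg_color_class c k v : symm c ->
  deg (color_class c k) v = #|[set y | e v y && (c v y == k)]|.
Proof.
move=> cS; rewrite /deg -(@card_in_imset _ _ (fun y => [set v; y])); last first.
  move=> y z _ _ /set2_eq[[_ ->] //|[<- ->]] //.
apply: eq_card => f; rewrite inE; apply/andP/imsetP.
  case=> /imset2P[a b _]; rewrite !inE /= => /andP[eab cab] ->; rewrite !inE => /orP[]/eqP ->.
    by exists b; rewrite // inE eab.
  by exists a; rewrite ?inE 1?e_sym ?eab 1?cS // setUC.
case=> y; rewrite inE => h ->; split; last by rewrite !inE eqxx.
by rewrite color_classP.
Qed.

Lemma cross_point c v : cross e c [set v] (~: [set v]) = \sum_(y in [set y | e v y]) c v y.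
Proof.
rewrite /cross (reindex_onto (pair v) snd) /=.
  apply: eq_bigl => y; rewrite !inE !eqxx andbT /=.
  by case: (eqVneq y v) => [->|_] //; rewrite e_irr.
by move=> [a b] /= /andP[/set1P->].
Qed.

Lemma cross_sym c A B : symm c -> cross e c A B = cross e c B A.
Proof.
move=> cS; rewrite /cross (reindex_onto (fun p => (p.2, p.1)) (fun p => (p.2, p.1))) /=;
  last by case.
apply: eq_big => [p|p _]; last by rewrite cS.
by case: p => a b /=; rewrite eqxx andbT e_sym andbCA.
Qed.

Lemma valid_colors c v : valid (cross e c [set v] (~: [set v])) ->
  [/\ forall y, e v y -> c v y <= 2,
    #|[set y | e v y && (c v y == 1)]| = 0 \/ #|[set y | e v y && (c v y == 1)]| = 2 &
    #|[set y | e v y && (c v y == 2)]| <= 1].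
Proof.
rewrite cross_point; have := e_cubic v; set A := [set y | e v y] => A3.
have E k : #|[set y | e v y && (c v y == k)]| = \sum_(y in A) (c v y == k).
  rewrite -sum1_card big_mkcond [RHS]big_mkcond; apply: eq_bigr => y _; rewrite !inE.
  by case: (e v y); case: (_ == k).
rewrite !E.
have [a [b [d [us AE]]]] : exists a b d, uniq [:: a; b; d] /\ A = [set a; b; d].
  have := cardE A; rewrite A3; case Es: (enum A) => [|a [|b [|d [|]]]] //= _.
  exists a, b, d; split; first by have := enum_uniq A; rewrite Es.
  apply/setP => z; by rewrite -mem_enum Es !inE orbA.
have S_third (F : T -> nat) : \sum_(y in A) F y = F a + F b + F d.
  have [ab ad bd] := uniq3 us; rewrite AE setUC big_setU1 /=; last first.
    by rewrite !inE negb_or eq_sym ad eq_sym bd.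
  by rewrite big_setU1 ?inE // big_set1 addnC.
rewrite !S_third => V; split.
- move=> y; have -> : e v y = (y \in A) by rewrite inE.
  rewrite AE !inE -orbA => /or3P[] /eqP->; move: V; rewrite /valid; clear; lia.
- by move: V; rewrite /valid; clear; lia.
- by move: V; rewrite /valid; clear; lia.
Qed.

Lemma color_classes_decompose c : symm c ->
  (forall v, valid (cross e c [set v] (~: [set v]))) -> tree_on (trel e c) setT ->
  three_decomposition e.
Proof.
move=> cS V Tr; have V' v := valid_colors (V v).
have sub k : color_class c k \subset edges e.
  apply/subsetP => f /imset2P[a b _]; rewrite !inE /= => /andP[eab _] ->.
  by apply/imset2P; exists a b; rewrite ?inE.
have dis k k' : k != k' -> [disjoint color_class c k & color_class c k'].
  move=> kk; apply: disjointI => f /imset2P[a b _]; rewrite !inE /= => /andP[eab /eqP cab] ->.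
  by rewrite color_classP // eab cab.
exists (color_class c 0), (color_class c 1), (color_class c 2); split.
- apply/eqP; rewrite eqEsubset !subUset !sub /=; apply/subsetP => f /imset2P[a b _].
  rewrite !inE /= => eab ->; rewrite !color_classP // eab /=.
  by have [/(_ b eab) + _ _] := V' a; case: (c a b) => [|[|[|]]].
- by rewrite !dis.
- split=> //; apply: tree_on_is_tree; first by move=> x y; rewrite /erel setUC.
  by apply: tree_on_ext Tr => x y _ _; rewrite /erel color_classP.
- by split=> // v; rewrite deg_color_class //; have [] := V' v.
- by split=> // v; rewrite deg_color_class //; have [] := V' v.
Qed.

Lemma good_point_decompose v : good e [set~ v] -> three_decomposition e.
Proof.
case=> _ G; have /card_gt0P[u] : 0 < #|[set y | e v y]| by rewrite e_cubic.
rewrite inE => vu; have uv : v != u by apply: contraTneq vu => ->; rewrite e_irr.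
(* Colour 0 at [u] and 1 elsewhere, so that [v] sees 0, 1, 1. Only the colours at [v] are sure to
   survive the filling of the complement. *)
pose c0 x y : nat := (x != u) && (y != u).
have c0S : symm c0 by move=> x y; rewrite /c0 andbC.
have c0V : cross e c0 [set v] (~: [set v]) = 2.
  rewrite cross_point (bigD1 u) ?inE //= {1}/c0 eqxx andbF add0n.
  have := e_cubic v; rewrite -sum1_card (bigD1 u) ?inE //= => -[<-].
  by apply: eq_bigr => y /andP[_ yu]; rewrite /c0 uv yu.
have [|c [cS cE cV cT]] := G c0 c0S; first by rewrite setCK cross_sym // c0V.
apply: (color_classes_decompose cS) => [w|].
  case: (eqVneq w v) => [->|wv]; last by apply: cV; rewrite !inE.
  rewrite (eq_cross (w' := c0)) ?c0V // => x y /set1P-> _ _.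
  by apply: cE; rewrite !inE eqxx.
have cv x : c x v = c0 x v by apply: cE; rewrite !inE eqxx andbF.
(* The edge from [u] is the only tree edge at [v], which becomes a leaf of the tree spanning the
   complement. *)
rewrite -(setUCr [set v]) setUC; apply: (tree_join (a := u) (b := v)) => //.
- by move=> x y; rewrite /trel e_sym cS.
- by move=> x; rewrite /trel e_irr.
- exact: tree_on1.
- by rewrite disjoint_sym disjoints1 !inE eqxx.
- by rewrite !inE eq_sym.
- by rewrite inE.
- by rewrite /trel e_sym vu cv /c0 eqxx.
- move=> x y _ /set1P->; rewrite /trel cv /c0 uv andbT => /andP[_].
  by case: (eqVneq x u).
Qed.

End Decomposition.

Theorem theorem5 (T : finType) (e : rel T)
    (e_sym : symmetric e) (e_irr : irreflexive e) :
  cubic e -> k_connected e 3 -> treewidth_eq e 3 -> three_decomposition e.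
Proof.
move=> cub con [[I [t [B [td B4]]]] tw].
have [v gv] : exists v, good e [set~ v].
  apply: (good_point e_sym e_irr cub con td B4).
  (* Without a bag of four vertices the decomposition would have width at most 2. *)
  case: (boolP [exists i, #|B i| == 4]) => [/existsP[i /eqP]|no]; first by exists i.
  case: (tw 2 isT); exists I, t, B; split=> // i.
  have := B4 i; rewrite leq_eqVlt => /orP[Bi|//].
  by case/existsP: no; exists i.
exact: good_point_decompose e_sym e_irr cub _ gv.
Qed.
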